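(* Let $n\ge2$, $d\ge1$, $\ell\ge1$ be integers, $d_0=\lceil d/2\rceil$, $c\in\mathbb{R}^\ell$, let $\hat a_0,\dots,\hat a_\ell\in\mathbb{R}^{\mathbb{N}_d^{n-1}}$ and $f_0,\dots,f_\ell$ be the data of the conic problem, with $K$ a Cartesian product of linear, second-order and semidefinite cones. Assume the vectors $\hat a_0,\dots,\hat a_\ell$ are linearly independent. Suppose that $$(P)\qquad \min\ c^Tw\quad\text{s.t.}\quad \hat a_0+\sum_{i=1}^\ell w_i\hat a_i\in\mathcal{R}_d(\overline{\Delta}),\quad f_0+\sum_{i=1}^\ell w_if_i\in K$$ is feasible, and that $$(D)\qquad \max\ -\langle\hat a_0,\hat p\rangle-f_0^T\eta\quad\text{s.t.}\quad\langle\hat a_i,\hat p\rangle+f_i^T\eta=c_i\ (i=1,\dots,\ell),\quad\hat p\in\mathcal{P}_d(\overline{\Delta}),\ \eta\in K^*$$ has a feasible $\hat p$ (i.e. a feasible pair $(\hat p,\eta)$) that is positive on $\overline{\Delta}$. For each $k\ge d_0$ let $(w^{(k)},z^{(k)})$ be a minimizer of the $k$th order moment relaxation $$(P_k)\qquad\begin{array}{cl}\min & c^Tw\\ \text{s.t.}& \hat a_0+\sum_{i=1}^\ell w_i\hat a_i=z|_d,\quad f_0+\sum_{i=1}^\ell w_if_i\in K,\\ & M_k[z]\succeq0,\quad L_{g_i}^{(k)}[z]\succeq0\ (i=1,\dots,n+1),\quad z\in\mathbb{R}^{\mathbb{N}_{2k}^{n-1}},\end{array}$$ where $(g_1,\dots,g_{n+1})=(x_1,\dots,x_{n-1},1-e^T\bar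 x,1-\|\bar x\|^2)$. Then the sequence $\{w^{(k)}\}_{k=d_0}^\infty$ is bounded, and each of its accumulation points is a minimizer of $(P)$.
   Context: Write $x=(x_1,\dots,x_n)$, $\bar x=(x_1,\dots,x_{n-1})$; $e$ is the all-ones vector of appropriate length. $\mathbb{N}_m^{n-1}=\{\alpha\in\mathbb{N}^{n-1}:|\alpha|\le m\}$ with $|\alpha|=\sum_i\alpha_i$, and $\overline{\mathbb{N}}_d^n=\{\alpha\in\mathbb{N}^n:|\alpha|=d\}$. Vectors labelled by multi-indices pair with polynomials by $\langle\sum_\alpha p_\alpha\bar x^\alpha,z\rangle=\langle z,\sum_\alpha p_\alpha\bar x^\alpha\rangle=\sum_\alpha p_\alpha z_\alpha$. $z|_d$ is the subvector of $z$ labelled by $\mathbb{N}_d^{n-1}$. Origin of the data: the linear conic problem with completely positive (CP) tensors is to minimize $c^Tw$ subject to $\mathcal{A}_0+\sum_{i=1}^\ell w_i\mathcal{A}_i$ being CP and $f_0+\sum_{i=1}^\ell w_if_i\in K$, where $w\in\mathbb{R}^\ell$, $\mathcal{A}_0,\dots,\mathcal{A}_\ell$ are given real symmetric tensors of order $d$ over $\mathbb{R}^n$, and $f_0,\dots,f_\ell$ are given vectors in the ambient space of $K$ (a symmetric tensor is CP if it is a sum of $v^{\otimes d}$ with $v\in\mathbb{R}^n_+$). One sets $(a_i)_\alpha=(\mathcal{A}_i)_{j_1\ldots j_d}$ whenever $x^\alpha=x_{j_1}\cdots x_{j_d}$, $\alpha\in\overline{\mathbb{N}}_d^n$, and $(\hat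 a_i)_\alpha=\langle\bar x^\alpha(e^Tx)^{d-|\alpha|},a_i\rangle$ for $\alpha\in\mathbb{N}_d^{n-1}$ (where $\langle\sum_\beta p_\beta x^\beta,a_i\rangle=\sum_\beta p_\beta(a_i)_\beta$). $K^*$ is the dual cone of $K$; the pairing is written $f^T\eta$. $\overline{\Delta}=\{\bar x\in\mathbb{R}^{n-1}:\bar x\ge0,\ 1-e^T\bar x\ge0\}$. $\mathcal{R}_d(\overline{\Delta})=\{\sum_{i=1}^r\lambda_i[v_i]_d:v_i\in\overline{\Delta},\lambda_i\ge0,r\in\mathbb{N}\}$ with $[v]_d=(v^\alpha)_{\alpha\in\mathbb{N}_d^{n-1}}$. $\mathcal{P}_d(\overline{\Delta})$ is the cone of polynomials in $\bar x$ of degree at most $d$ that are nonnegative on $\overline{\Delta}$. For $z\in\mathbb{R}^{\mathbb{N}_{2k}^{n-1}}$ and a polynomial $q$ in $\bar x$ of degree at most $2k$, $L_q^{(k)}[z]$ is the symmetric matrix, indexed by monomials of degree at most $k-\lceil\deg(q)/2\rceil$, with $\langle qa^2,z\rangle=\mathrm{vec}(a)^TL_q^{(k)}[z]\mathrm{vec}(a)$ for all polynomials $a$ with $\deg(qa^2)\le2k$, where $\mathrm{vec}(a)$ is the coefficient vector of $a$; $M_k[z]=L_1^{(k)}[z]$. *)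

(* Defs.v *)
From HB Require Import structures.
From mathcomp Require Import all_boot all_order all_algebra.
From mathcomp Require Import fingroup perm zify.
From mathcomp Require Import all_classical all_reals all_analysis.
(* The notations of mpoly clash with those of analysis; everything else in
   mpoly is imported: [mpoly n R] is the ring of polynomials in n variables,
   [multinom n] = N^n, [bmultinom n b] = {alpha in N^n : |alpha| < b}. *)
From mathcomp Require Import -(notations) mpoly.

Set Implicit Arguments.
Unset Strict Implicit.
Unset Printing Implicit Defensive.

Import Order.TTheory GRing.Theory Num.Theory numFieldNormedType.Exports.
Local Open Scope ring_scope.

(* R^(N_t^m).  The codomain is R^o so that this is a vectType. *)
Definition mvec (R : realType) (m t : nat) : Type :=
  {ffun bmultinom m t.+1 -> R^o}.

(* The multi-indices alpha in N^n with |alpha| = d. *)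
Notation hmultinom n d := {alpha : bmultinom n d.+1 | mdeg alpha == d}.

Definition hlabel (n d : nat) (alpha : hmultinom n d) : multinom n :=
  bmnm (val alpha).

Definition hvec (R : realType) (n d : nat) : Type :=
  {ffun hmultinom n d -> R^o}.

Definition mvar (R : realType) (m : nat) (i : 'I_m) : mpoly m R :=
  mpolyX R (mnm1 i).

(* The pairing <p, z> = \sum_alpha p_alpha z_alpha.  Coefficients of p outside
   the label set are ignored; it is only used when there are none. *)
Definition pairing (R : realType) (m t : nat) (p : mpoly m R) (z : mvec R m t)
    : R :=
  \sum_(alpha : bmultinom m t.+1) mcoeff alpha p * z alpha.

Definition hpairing (R : realType) (n d : nat) (p : mpoly n R) (a : hvec R n d)
    : R :=
  \sum_(alpha : hmultinom n d) mcoeff (hlabel alpha) p * a alpha.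

(* z|_d.  For d <= t the index alpha is always a label of z and the default
   value 0 is never used. *)
Definition mrestrict (R : realType) (m t d : nat) (z : mvec R m t)
    : mvec R m d :=
  [ffun alpha : bmultinom m d.+1 =>
     oapp (fun beta : bmultinom m t.+1 => z beta) 0
          (insub (bmnm alpha) : option (bmultinom m t.+1))].

(* A tensor of order d over R^n; the entry A_(j_1 ... j_d) is A j. *)
Definition tensor (R : realType) (n d : nat) : Type := {ffun 'I_d -> 'I_n} -> R.

Definition sym_tensor (R : realType) (n d : nat) (A : tensor R n d) : Prop :=
  forall (s : 'S_d) (j : {ffun 'I_d -> 'I_n}), A [ffun k => j (s k)] = A j.

Definition tensor_vec (R : realType) (n d : nat) (A : tensor R n d)
    (a : hvec R n d) : Prop :=
  forall (alpha : hmultinom n d) (j : {ffun 'I_d -> 'I_n}),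
    mpolyX R (hlabel alpha) = \prod_(k < d) mvar R (j k) -> a alpha = A j.

(* \bar x^alpha (e^T x)^(d - |alpha|), as a polynomial in x_1, ..., x_n. *)
Definition homogenized (R : realType) (n d : nat) (alpha : multinom n.-1)
    : mpoly n R :=
  (\prod_(i < n.-1) mvar R (widen_ord (leq_pred n) i) ^+ alpha i)
  * (\sum_(i < n) mvar R i) ^+ (d - mdeg alpha).

Definition hat (R : realType) (n d : nat) (a : hvec R n d) : mvec R n.-1 d :=
  [ffun alpha : bmultinom n.-1 d.+1 => hpairing (homogenized R d alpha) a].

Definition simplex (R : realType) (m : nat) (x : 'I_m -> R) : Prop :=
  (forall i, 0 <= x i) /\ 0 <= 1 - \sum_(i < m) x i.

Definition monomials (R : realType) (m d : nat) (v : 'I_m -> R) : mvec R m d :=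
  [ffun alpha : bmultinom m d.+1 => \prod_(i < m) v i ^+ bmnm alpha i].

Definition moment_cone (R : realType) (m d : nat) (y : mvec R m d) : Prop :=
  exists (r : nat) (lambda : 'I_r -> R) (v : 'I_r -> 'I_m -> R),
    (forall i, 0 <= lambda i /\ simplex (v i))
    /\ y = \sum_(i < r) lambda i *: monomials d (v i).

(* [msize p] is 1 + the degree of p, and 0 if p = 0. *)
Definition nonneg_poly (R : realType) (m d : nat) (p : mpoly m R) : Prop :=
  (msize p <= d.+1)%N /\ forall x, simplex x -> 0 <= meval x p.

Definition psd (R : realType) (T : finType) (A : T -> T -> R) : Prop :=
  (forall i j, A i j = A j i)
  /\ forall v : T -> R, 0 <= \sum_i \sum_j v i * A i j * v j.

Definition half_deg (R : realType) (m : nat) (q : mpoly m R) : nat :=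
  uphalf (msize q).-1.

(* L_q^(k)[z], with rows and columns labelled by the monomials of degree at
   most k - ceil(deg q / 2); [localizingP] is its defining property. *)
Definition localizing (R : realType) (m k : nat) (q : mpoly m R)
    (z : mvec R m (2 * k)) (alpha beta : bmultinom m (k - half_deg q).+1) : R :=
  pairing (q * mpolyX R alpha * mpolyX R beta) z.

Lemma localizing_sym (R : realType) (m k : nat) (q : mpoly m R)
    (z : mvec R m (2 * k)) (alpha beta : bmultinom m (k - half_deg q).+1) :
  localizing z alpha beta = localizing z beta alpha.
Proof. by rewrite /localizing mulrAC. Qed.

Lemma localizingP (R : realType) (m k : nat) (q : mpoly m R)
    (z : mvec R m (2 * k)) (a : mpoly m R) :
  (msize (q * a ^+ 2) <= (2 * k).+1)%N ->
  pairing (q * a ^+ 2) z =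
  \sum_alpha \sum_beta
    mcoeff (bmnm alpha) a * @localizing R m k q z alpha beta
    * mcoeff (bmnm beta) a.
Proof.
pose L (p : mpoly m R) := pairing p z.
have LD p p' : L (p + p') = L p + L p'.
  by rewrite /L /pairing -big_split; apply: eq_bigr => i _; rewrite mcoeffD mulrDl.
have LZ c p : L (c *: p) = c * L p.
  by rewrite /L /pairing mulr_sumr; apply: eq_bigr => i _; rewrite mcoeffZ mulrA.
have L0 : L 0 = 0 by rewrite -(scale0r 0) LZ mul0r.
have LS (T : finType) (F : T -> mpoly m R) : L (\sum_i F i) = \sum_i L (F i).
  exact: (big_morph L LD L0).
move=> h.
have [q0|qN0] := eqVneq q 0.
  have qM p : q * p = 0 by rewrite q0 mul0r.
  rewrite qM -[pairing _ _]/(L 0) L0; apply/esym.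
  apply: big1 => i _; apply: big1 => j _.
  by rewrite /localizing qM mul0r -[pairing _ _]/(L 0) L0 mulr0 mul0r.
have [a0|aN0] := eqVneq a 0.
  rewrite a0 expr0n /= mulr0 -[pairing _ _]/(L 0) L0; apply/esym.
  by apply: big1 => i _; apply: big1 => j _; rewrite mcoeff0 !mul0r.
have sa : (msize a <= (k - half_deg q).+1)%N.
  move: h; rewrite expr2 !msizeM ?mulf_neq0 //.
  have : (0 < msize q)%N by rewrite lt0n mmeasure_poly_eq0.
  have : (0 < msize a)%N by rewrite lt0n mmeasure_poly_eq0.
  rewrite /half_deg; case: (mmeasure _ q) => // s; case: (mmeasure _ a) => // t _ _.
  by rewrite uphalfE; lia.
have ea := mpolywE sa.
rewrite {1}ea expr2.
rewrite mulr_suml mulr_sumr -[LHS]/(L _) LS; apply: eq_bigr => i _.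
rewrite mulr_sumr mulr_sumr LS; apply: eq_bigr => j _.
rewrite -scalerAl -!scalerAr !LZ /localizing -/(L _) mulrA.
by rewrite mulrAC mulrA.
Qed.

(* g_1, ..., g_(m+2): the coordinates, 1 - e^T x and 1 - ||x||^2. *)
Definition constraint_polys (R : realType) (m : nat) : seq (mpoly m R) :=
  [seq mvar R i | i <- enum 'I_m]
  ++ [:: 1 - \sum_(i < m) mvar R i; 1 - \sum_(i < m) mvar R i ^+ 2].

(* [LinCone s] is R^s_+, [SOCone s] is {(t, u) in R x R^s : ||u||_2 <= t} and
   [SDCone s] is the cone of psd symmetric s x s matrices. *)
Inductive cone_block := LinCone of nat | SOCone of nat | SDCone of nat.

Definition block_rows (b : cone_block) : nat :=
  match b with LinCone _ => 1 | SOCone _ => 1 | SDCone s => s end.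

Definition block_cols (b : cone_block) : nat :=
  match b with LinCone s => s | SOCone s => s.+1 | SDCone s => s end.

Definition in_block_space (R : realType) (b : cone_block)
    : 'M[R]_(block_rows b, block_cols b) -> Prop :=
  match b with
  | LinCone s => fun=> True
  | SOCone s => fun=> True
  | SDCone s => fun X => X^T = X
  end.

Definition in_block (R : realType) (b : cone_block)
    : 'M[R]_(block_rows b, block_cols b) -> Prop :=
  match b with
  | LinCone s => fun x => forall i, 0 <= x 0 i
  | SOCone s => fun x =>
      Num.sqrt (\sum_(i < s) x 0 (lift ord0 i) ^+ 2) <= x 0 ord0
  | SDCone s => fun X => psd (fun i j => X i j)
  end.

Definition cone_vec (R : realType) (N : nat) (K : 'I_N -> cone_block) : Type :=
  forall j : 'I_N, 'M[R]_(block_rows (K j), block_cols (K j)).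

(* The ambient space of K: matrix blocks are symmetric. *)
Definition in_space (R : realType) (N : nat) (K : 'I_N -> cone_block)
    (f : cone_vec R K) : Prop :=
  forall j, in_block_space (f j).

Definition in_cone (R : realType) (N : nat) (K : 'I_N -> cone_block)
    (f : cone_vec R K) : Prop :=
  forall j, in_block (f j).

(* f^T eta; on matrix blocks this is the trace inner product. *)
Definition cone_dot (R : realType) (N : nat) (K : 'I_N -> cone_block)
    (f eta : cone_vec R K) : R :=
  \sum_(j < N) \sum_r \sum_s f j r s * eta j r s.

Definition in_dual_cone (R : realType) (N : nat) (K : 'I_N -> cone_block)
    (eta : cone_vec R K) : Prop :=
  in_space eta /\ forall f, in_cone f -> 0 <= cone_dot f eta.

(* Index 0 is [ord0]; i = 1, ..., l is [lift ord0 i] with i : 'I_l. *)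
Definition mvec_pencil (R : realType) (m d l : nat)
    (ahat : 'I_l.+1 -> mvec R m d) (w : 'cV[R]_l) : mvec R m d :=
  ahat ord0 + \sum_(i < l) w i 0 *: ahat (lift ord0 i).

Definition cone_pencil (R : realType) (l N : nat) (K : 'I_N -> cone_block)
    (f : 'I_l.+1 -> cone_vec R K) (w : 'cV[R]_l) : cone_vec R K :=
  fun j => f ord0 j + \sum_(i < l) w i 0 *: f (lift ord0 i) j.

Definition objective (R : realType) (l : nat) (c w : 'cV[R]_l) : R :=
  (c^T *m w) 0 0.

Definition feasible_P (R : realType) (m d l N : nat) (K : 'I_N -> cone_block)
    (ahat : 'I_l.+1 -> mvec R m d) (f : 'I_l.+1 -> cone_vec R K)
    (w : 'cV[R]_l) : Prop :=
  moment_cone (mvec_pencil ahat w) /\ in_cone (cone_pencil f w).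

Definition minimizer_P (R : realType) (m d l N : nat) (K : 'I_N -> cone_block)
    (c : 'cV[R]_l) (ahat : 'I_l.+1 -> mvec R m d) (f : 'I_l.+1 -> cone_vec R K)
    (w : 'cV[R]_l) : Prop :=
  feasible_P ahat f w
  /\ forall w', feasible_P ahat f w' -> objective c w <= objective c w'.

Definition feasible_D (R : realType) (m d l N : nat) (K : 'I_N -> cone_block)
    (c : 'cV[R]_l) (ahat : 'I_l.+1 -> mvec R m d) (f : 'I_l.+1 -> cone_vec R K)
    (p : mpoly m R) (eta : cone_vec R K) : Prop :=
  [/\ forall i : 'I_l,
        pairing p (ahat (lift ord0 i)) + cone_dot (f (lift ord0 i)) eta = c i 0,
      nonneg_poly d p
    & in_dual_cone eta].

Definition feasible_Pk (R : realType) (m d l N : nat) (K : 'I_N -> cone_block)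
    (ahat : 'I_l.+1 -> mvec R m d) (f : 'I_l.+1 -> cone_vec R K) (k : nat)
    (w : 'cV[R]_l) (z : mvec R m (2 * k)) : Prop :=
  [/\ mvec_pencil ahat w = mrestrict d z,
      in_cone (cone_pencil f w),
      psd (@localizing R m k 1 z)
    & forall q, q \in constraint_polys R m -> psd (@localizing R m k q z)].

Definition minimizer_Pk (R : realType) (m d l N : nat) (K : 'I_N -> cone_block)
    (c : 'cV[R]_l) (ahat : 'I_l.+1 -> mvec R m d) (f : 'I_l.+1 -> cone_vec R K)
    (k : nat) (w : 'cV[R]_l) (z : mvec R m (2 * k)) : Prop :=
  feasible_Pk ahat f w z
  /\ forall (w' : 'cV[R]_l) (z' : mvec R m (2 * k)),
       feasible_Pk ahat f w' z' -> objective c w <= objective c w'.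

(* Main.v *)
Require Import Defs.
From HB Require Import structures.
From mathcomp Require Import all_boot all_order all_algebra.
From mathcomp Require Import all_classical all_reals all_analysis.
From mathcomp Require Import ring lra zify.
From mathcomp Require Import -(notations) mpoly.

Import Order.TTheory GRing.Theory Num.Theory numFieldNormedType.Exports.
Local Open Scope classical_set_scope.
Local Open Scope ring_scope.

(**
The difficulty is to pass from the semidefinite constraints on [z], which say
that the linear form [p |-> pairing p z] is nonnegative on the polynomials
[q a^2] with [q] a constraint and bounded degree, to the statement that [z] is
close to the moment vector of a measure on the simplex.  This is usually a
consequence of Putinar's Positivstellensatz together with conic duality; the
argument below is direct.

Polynomials on which the relaxations of all large orders are nonnegative form
a quadratic module Q ([eventually_nonneg_qm]) that contains the barycentric
coordinates x_0, ..., x_m of the simplex and, since their sum is 1, also the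
polynomials 1 - x_i.  Riesz's proof that the product of two commuting positive
operators is positive is purely algebraic, and shows that every product of
barycentric coordinates is in Q up to an arbitrarily small constant ([qm_mul],
[qm_prod]).

Expand 1 = (x_0 + ... + x_m)^N into words of length N.  The form defined by
[z] is nearly nonnegative on each word, so the words are the atoms of a
measure: the word h receives the weight given by [z] and sits at the point of
the simplex whose barycentric coordinates are the letter frequencies of h.  By
the law of large numbers ([sampling]) this measure has nearly the moments [z].
Hence, for k large, the restriction of any feasible [z] to degree d is within
e times the mass of [z] of the moment cone ([near_moment_cone]).

The rest follows from this approximation.  A dual feasible polynomial p that
is positive on the simplex satisfies <p, z> >= (e / 2) <1, z> for large k
([near_positive]); with weak duality and the value of a feasible point of (P),
this bounds the mass of z^(k), then its moments of degree at most d, and then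
w^(k) by linear independence.  An accumulation point w* thus has a pencil that
is a limit of points of the moment cone, which is closed by Caratheodory's
theorem and compactness ([moment_cone_closed]), so w* is feasible.  It is
optimal because each relaxation has a value at most that of (P)
([moment_cone_relaxed]).
*)

(** * Quadratic modules and Riesz's product argument *)

Definition quadratic_module (R : realType) (A : comAlgType R) (Q : A -> Prop) :=
  [/\ Q 1, forall p q, Q p -> Q q -> Q (p + q)
    & forall a p, Q p -> Q (a ^+ 2 * p)].

Section QuadraticModule.
Variables (R : realType) (A : comAlgType R) (Q : A -> Prop).
Hypothesis Qm : quadratic_module R A Q.

Lemma qm_add p q : Q p -> Q q -> Q (p + q).
Proof. by case: Qm => _ + _; exact. Qed.

Lemma qm_sqr_mul a p : Q p -> Q (a ^+ 2 * p).
Proof. by case: Qm => _ _; exact. Qed.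

Lemma qm_sqr a : Q (a ^+ 2).
Proof. by rewrite -[_ ^+ 2]mulr1; apply: qm_sqr_mul; case: Qm. Qed.

Lemma qm0 : Q 0.
Proof. by have := qm_sqr 0; rewrite expr0n. Qed.

Lemma qm_scale (c : R) p : 0 <= c -> Q p -> Q (c *: p).
Proof.
move=> c0 Qp; have := qm_sqr_mul ((Num.sqrt c)%:A) _ Qp.
by rewrite expr2 -mulrA !mulr_algl scalerA -expr2 sqr_sqrtr.
Qed.

Lemma qm_const (c : R) : 0 <= c -> Q c%:A.
Proof. by move=> c0; apply: qm_scale => //; case: Qm. Qed.

Lemma qm_descale (c : R) p : 0 < c -> Q (c%:A * p) -> Q p.
Proof.
move=> c0 /(qm_scale c^-1); rewrite mulr_algl scalerA mulVf ?gt_eqF// scale1r.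
by apply; rewrite invr_ge0 ltW.
Qed.

Lemma qm_sum (I : Type) (r : seq I) (P : pred I) (F : I -> A) :
  (forall i, P i -> Q (F i)) -> Q (\sum_(i <- r | P i) F i).
Proof. by move=> QF; apply: big_ind => //; [exact: qm0 | exact: qm_add]. Qed.

Lemma qm_two p : Q (p + p) -> Q p.
Proof.
move=> H; apply: (qm_descale 2%:R) => //.
by rewrite scaler_nat mulr_natl mulr2n.
Qed.

(** Q contains the difference of squares, although a quadratic module need
    not be closed under products: multiplying [c - t] and [c + t] by the
    squares of each other and adding yields [2 c (c - t) (c + t)]. *)
Lemma qm_sqr_le (c : R) t : 0 < c -> Q (c%:A - t) -> Q (c%:A + t) ->
  Q (c%:A ^+ 2 - t ^+ 2).
Proof.
move=> c0 Qm1 Qp1; apply: qm_two; apply: (qm_descale _ _ c0).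
set C : A := c%:A in Qm1 Qp1 *.
suff -> : C * (C ^+ 2 - t ^+ 2 + (C ^+ 2 - t ^+ 2)) =
  (C - t) ^+ 2 * (C + t) + (C + t) ^+ 2 * (C - t).
  by apply: qm_add; apply: qm_sqr_mul.
ring.
Qed.

(** F. Riesz used this recursion to show that the product of two commuting
    positive operators is positive: the squares subtracted along the way sum up
    to [f], up to a remainder that tends to 0 if [0 <= f <= 1]. *)
Definition riesz (f : A) (k : nat) : A := iter k (fun t => t - t ^+ 2) f.

Lemma rieszS f k : riesz f k.+1 = riesz f k - riesz f k ^+ 2.
Proof. by []. Qed.

Lemma riesz_ge0_le1 f k : Q f -> Q (1 - f) -> Q (riesz f k) /\ Q (1 - riesz f k).
Proof.
move=> Qf Qf1; elim: k => [//|k [Qk Qk1]]; rewrite rieszS.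
set t := riesz f k in Qk Qk1 *; split.
  suff -> : t - t ^+ 2 = t ^+ 2 * (1 - t) + (1 - t) ^+ 2 * t.
    by apply: qm_add; apply: qm_sqr_mul.
  ring.
suff -> : 1 - (t - t ^+ 2) = (1 - t) + t ^+ 2 by apply: qm_add => //; exact: qm_sqr.
ring.
Qed.

Lemma riesz_sum f k : f = \sum_(j < k) riesz f j ^+ 2 + riesz f k.
Proof.
elim: k => [|k IH]; first by rewrite big_ord0 add0r.
rewrite rieszS big_ord_recr /= {1}IH -addrA; congr (_ + _).
by rewrite addrC subrK.
Qed.

(** The remainder at stage [k] is at most [1 / (k + 1)]: the map [t - t ^ 2]
    is increasing for [t <= 1 / 2], with the certificate
    [(c - c ^ 2) - (t - t ^ 2) = (1 - 2 c) (c - t) + (c - t) ^ 2]. *)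
Lemma riesz_le f k : Q f -> Q (1 - f) -> Q ((k.+1%:R^-1)%:A - riesz f k).
Proof.
move=> Qf Qf1; elim: k => [|k IH]; first by rewrite invr1 scale1r.
rewrite rieszS.
set t := riesz f k in IH *.
(* The factor [1 - 2 c] of the certificate is negative for [c = 1], hence a
   separate argument for the first step. *)
case: k => [|k] in t IH *.
  apply: (qm_descale 2) => //.
  suff -> : 2%:A * (2^-1%:A - (t - t ^+ 2)) = (1 - t) ^+ 2 + t ^+ 2.
    by apply: qm_add; apply: qm_sqr.
  rewrite mulrBr mulr_algl scalerA mulfV ?pnatr_eq0// scale1r scaler_nat.
  ring.
set c : R := k.+2%:R^-1 in IH *.
have c0 : 0 < c by rewrite invr_gt0.
have cc : c - c ^+ 2 <= k.+3%:R^-1.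
  have a0 : (0 : R) < k.+2%:R by [].
  rewrite /c [k.+3%:R]mulrS -subr_ge0; set a : R := k.+2%:R in a0 *.
  have -> : (1 + a)^-1 - (a^-1 - a^-1 ^+ 2) = (a ^+ 2 * (1 + a))^-1.
    by field; rewrite !gt_eqF//; lra.
  by rewrite invr_ge0 mulr_ge0 ?exprn_ge0//; lra.
have c2 : 0 <= 1 - c *+ 2.
  rewrite -mulr_natl subr_ge0 -ler_pdivlMl// mulr1 lef_pV2 ?posrE//.
  by rewrite ler_nat.
have -> : (k.+3%:R^-1 : R)%:A = (k.+3%:R^-1 - (c - c ^+ 2) : R)%:A
   + (c%:A - c%:A ^+ 2) :> A.
  rewrite !expr2 -scalerAl mul1r scalerA -!scalerBl -scalerDl; congr (_ *: _).
  by rewrite subrK.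
rewrite -addrA; apply: qm_add; first by apply: qm_const; rewrite subr_ge0.
have -> : c%:A - c%:A ^+ 2 - (t - t ^+ 2) =
   (1 - c *+ 2)%:A * (c%:A - t) + (c%:A - t) ^+ 2.
  rewrite scalerBl scale1r -scalerMnl.
  by set C : A := c%:A; ring.
by apply: qm_add; [rewrite mulr_algl; apply: qm_scale | apply: qm_sqr].
Qed.

Lemma qm_sqr_le1 f : Q f -> Q (1 - f) -> Q (1 - f ^+ 2).
Proof.
move=> Qf Qf1; have := qm_sqr_le 1 f ltr01; rewrite scale1r expr1n; apply => //.
by apply: qm_add => //; case: Qm.
Qed.

(** A quadratic module is not closed under products ([x y] is not in the one
    generated by the constraints of a triangle), but it becomes so after adding
    an arbitrarily small constant.  Write [f] as a sum of squares plus a small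
    remainder [t]: the squares may multiply [g], and [t g] is bounded below
    because [(t + c g) ^ 2 >= 0] while [t <= c] and [g ^ 2 <= 1]. *)
Lemma qm_mul f g : Q f -> Q (1 - f) ->
  (forall e : R, 0 < e -> Q (g + e%:A)) -> Q (1 - g ^+ 2) ->
  forall e : R, 0 < e -> Q (f * g + e%:A).
Proof.
move=> Qf Qf1 Qg Qg1 e e0.
pose N := Num.truncn (2%:R / e).
have cN : N.+1%:R^-1 <= e / 2%:R :> R.
  rewrite -[leRHS]invrK lef_pV2 ?posrE ?invr_gt0 ?divr_gt0// invf_div.
  by apply: ltW; apply: truncnS_gt.
set c : R := N.+1%:R^-1 in cN.
have c0 : 0 < c by rewrite invr_gt0.
have [Qt Qt1] := riesz_ge0_le1 f N Qf Qf1.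
have Qct : Q (c%:A - riesz f N) by exact: riesz_le.
set t := riesz f N in Qt Qt1 Qct.
pose S := \sum_(j < N) riesz f j ^+ 2.
have fE : f = S + t by rewrite {1}(riesz_sum f N).
have QS1 : Q (1 - S).
  have -> : 1 - S = (1 - f) + t by rewrite {1}fE opprD addrA subrK.
  exact: qm_add.
have e20 : 0 < e / 2%:R by rewrite divr_gt0.
have -> : f * g + e%:A = S * (g + (e / 2%:R)%:A) + (e / 2%:R)%:A * (1 - S)
   + (t * g + c%:A) + (e / 2%:R - c)%:A.
  have -> : e%:A = (e / 2%:R)%:A + (e / 2%:R)%:A :> A.
    by rewrite -scalerDl -splitr.
  by rewrite [(e / 2 - c)%:A]scalerBl {1}fE; ring.
apply: qm_add; last by apply: qm_const; rewrite subr_ge0.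
apply: qm_add; first apply: qm_add.
- by rewrite mulr_suml; apply: qm_sum => i _; apply: qm_sqr_mul; apply: Qg.
- by rewrite mulr_algl; apply: qm_scale => //; exact: ltW.
apply: qm_two; apply: (qm_descale _ _ c0).
have Qtt : Q (c%:A ^+ 2 - t ^+ 2).
  by apply: qm_sqr_le => //; apply: qm_add => //; apply: qm_const; exact: ltW.
set C : A := c%:A in Qtt *.
have -> : C * (t * g + C + (t * g + C)) =
  (t + C * g) ^+ 2 + (C ^+ 2 - t ^+ 2) + C ^+ 2 * (1 - g ^+ 2) by ring.
by apply: qm_add; [apply: qm_add => //; apply: qm_sqr | apply: qm_sqr_mul].
Qed.

Lemma qm_prod (I : Type) (r : seq I) (F : I -> A) :
  (forall i, Q (F i)) -> (forall i, Q (1 - F i)) ->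
  forall e : R, 0 < e -> Q (\prod_(i <- r) F i + e%:A).
Proof.
move=> QF QF1.
suff [] : (forall e : R, 0 < e -> Q (\prod_(i <- r) F i + e%:A)) /\
          Q (1 - (\prod_(i <- r) F i) ^+ 2) by [].
elim/big_rec: _ => [|i g _ [Qg Qg1]].
  split=> [e e0|]; last by rewrite expr1n subrr; exact: qm0.
  by apply: qm_add; [case: Qm | apply: qm_const; exact: ltW].
split; first exact: qm_mul.
have -> : 1 - (F i * g) ^+ 2 = g ^+ 2 * (1 - F i ^+ 2) + (1 - g ^+ 2) by ring.
by apply: qm_add => //; apply: qm_sqr_mul; exact: qm_sqr_le1.
Qed.

End QuadraticModule.

(** * Empirical measures of words *)

(** Sampling [b] positions among [N] with replacement produces a collision
    with probability at most [b ^ 2 / N]. *)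
Lemma leq_expn_ffact (N b : nat) :
  (N ^ b * N <= N ^_ b * N + b ^ 2 * N ^ b)%N.
Proof.
elim: b => [|b IH]; first by rewrite leq_addr.
have le : (N ^_ b <= N ^ b)%N.
  elim: {IH} b => // b IH; rewrite ffactnSr expnSr leq_mul//; exact: leq_subr.
have h1 : (N ^_ b * N <= N ^_ b.+1 + b * N ^ b)%N.
  rewrite ffactnSr (mulnC b); apply: leq_trans (_ : N ^_ b * (N - b) + N ^_ b * b <= _)%N.
    by rewrite -mulnDr leq_mul2l; apply/orP; right; lia.
  by rewrite leq_add2l leq_mul2r le orbT.
rewrite expnSr; set T := (N ^ b)%N in IH le h1 *; set F := (N ^_ b)%N in IH le h1.
set G := (N ^_ b.+1)%N in h1 *.
have h2 : (F * N * N <= (G + b * T) * N)%N by rewrite leq_mul2r h1 orbT.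
have h3 : (T * N * N <= (F * N + b ^ 2 * T) * N)%N by rewrite leq_mul2r IH orbT.
have -> : (b.+1 ^ 2 = b ^ 2 + b + b + 1)%N by rewrite -addn1; ring.
lia.
Qed.

Section Sampling.
Variables (I J B : finType).

(** For independent letters of law [x], the positions [phi] carry the word [u]
    with probability [\prod_b x (u b)].  For ring elements [x a] this is the same
    computation: each position outside [phi] contributes [\sum_a x a = 1]. *)
Lemma word_marginal (A : comNzRingType) (x : J -> A) (phi : B -> I) (u : B -> J) :
  \sum_a x a = 1 -> injective phi ->
  \sum_(h : {ffun I -> J})
     (\prod_i x (h i)) * (\prod_b (h (phi b) == u b)%:R) = \prod_b x (u b).
Proof.
move=> x1 phi_inj.
pose F i a := x a * \prod_(b | phi b == i) (a == u b)%:R.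
transitivity (\sum_(h : {ffun I -> J}) \prod_i F i (h i)).
  apply: eq_bigr => h _; rewrite big_split /=; congr (_ * _).
  rewrite (partition_big phi predT) //=; apply: eq_bigr => i _.
  by apply: eq_bigr => b /eqP ->.
rewrite -bigA_distr_bigA.
rewrite (bigID (mem (codom phi))) /= [X in _ * X]big1 ?mulr1; last first.
  move=> i /negP iphi; rewrite -[RHS]x1; apply: eq_bigr => a _.
  rewrite /F big1 ?mulr1// => b /eqP bi.
  by case: iphi; rewrite -bi codom_f.
have -> : \prod_(i in codom phi) \sum_a F i a = \prod_(i in phi @: B) \sum_a F i a.
  apply: eq_bigl => i; apply/codomP/imsetP; first by case=> b ->; exists b.
  by case=> b _ ->; exists b.
rewrite big_imset /=; last by move=> b c _ _; exact: phi_inj.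
apply: eq_bigr => b _; rewrite (bigD1 (u b)) //= [X in _ + X]big1 ?addr0.
  by rewrite /F big1 ?mulr1// => c /eqP /phi_inj ->; rewrite eqxx.
by move=> a /negPf ab; rewrite /F (bigD1 b) ?eqxx//= ab mul0r mulr0.
Qed.

Definition freq (R : realType) (h : {ffun I -> J}) (a : J) : R :=
  (\sum_i (h i == a)%:R) / #|I|%:R.

(** Expanding the product of averages gives the average over all ways to
    sample positions with replacement. *)
Lemma prod_freq (R : realType) (h : {ffun I -> J}) (u : B -> J) :
  \prod_b freq R h (u b) = (#|I| ^ #|B|)%:R^-1 *
    \sum_(phi : {ffun B -> I}) \prod_b (h (phi b) == u b)%:R.
Proof.
rewrite /freq big_split /= prodr_const mulrC exprVn -natrX; congr (_ * _).
exact: (bigA_distr_bigA (fun b i => (h i == u b)%:R)).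
Qed.

(** Law of large numbers for a functional [L] that is almost nonnegative on
    the words of length [#|I|]: the words, weighted by [L] and replaced by their
    letter frequencies, reproduce the moments of [L].  The average in
    [prod_freq] is exact on the injective samples, by [word_marginal], and the
    others are few.  This is the convergence of Bernstein polynomials, obtained
    without multinomial coefficients. *)
Lemma sampling (R : realType) (A : comAlgType R) (L : {scalar A}) (x : J -> A)
    (u : B -> J) (e : R) :
  (#|B| <= #|I|)%N -> (0 < #|I|)%N -> \sum_a x a = 1 -> 0 <= e ->
  (forall h : {ffun I -> J}, - e <= L (\prod_i x (h i))) ->
  `|L (\prod_b x (u b))
    - \sum_(h : {ffun I -> J}) L (\prod_i x (h i)) * \prod_b freq R h (u b)|
  <= (#|B| ^ 2)%:R / #|I|%:R * (2 * (L 1 + 2 * e * (#|J| ^ #|I|)%:R)).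
Proof.
move=> BI I0 x1 e0 Lx.
pose X (h : {ffun I -> J}) := \prod_i x (h i).
pose ind (phi : {ffun B -> I}) (h : {ffun I -> J}) : R := \prod_b (h (phi b) == u b)%:R.
pose D phi := L (\prod_b x (u b)) - \sum_h L (X h) * ind phi h.
set M := L 1 + _.
have sumX : \sum_h X h = 1.
  by rewrite /X -(bigA_distr_bigA (fun _ a => x a)) x1 big1.
have leM : \sum_h `|L (X h)| <= M.
  have -> : M = \sum_h (L (X h) + 2 * e).
    rewrite big_split /= -linear_sum sumX /M; congr (_ + _).
    by rewrite sumr_const card_ffun mulr_natr.
  apply: ler_sum => h _; have := Lx h; rewrite -/(X h).
  by move: (L (X h)) => y; rewrite ler_norml => ?; apply/andP; split; lra.
have ind01 phi h : 0 <= ind phi h <= 1.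
  apply/andP; split; first exact: prodr_ge0.
  by apply: prodr_ile1 => b _; case: (_ == _); rewrite ?ler01 ?lexx.
have leS phi : `|\sum_h L (X h) * ind phi h| <= M.
  apply: le_trans (ler_norm_sum _ _ _) _; apply: le_trans leM.
  apply: ler_sum => h _; rewrite normrM -[leRHS]mulr1 ler_wpM2l//.
  by have /andP[i0 i1] := ind01 phi h; rewrite ger0_norm.
have Dinj (phi : {ffun B -> I}) : injective phi -> D phi = 0.
  move=> phi_inj; rewrite /D -(word_marginal _ x phi u x1 phi_inj) linear_sum.
  rewrite -sumrB big1// => h _; apply/eqP; rewrite subr_eq0; apply/eqP.
  rewrite -/(X h).
  have -> : X h * \prod_b (h (phi b) == u b)%:R = ind phi h *: X h.
    rewrite /ind -mulr_algl mulrC; congr (_ * _).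
    rewrite -[RHS]/(in_alg A (\prod_b (h (phi b) == u b)%:R)) rmorph_prod.
    by apply: eq_bigr => b _; rewrite rmorph_nat.
  by rewrite linearZ mulrC.
have Lu : `|L (\prod_b x (u b))| <= M.
  have : exists phi : {ffun B -> I}, injective phi.
    have : (0 < #|fun f : {ffun B -> I} => injectiveb f|)%N.
      by have := card_inj_ffuns B I; rewrite cardsE => ->; rewrite ffact_gt0.
    by case/card_gt0P => phi /injectiveP; exists phi.
  case=> phi /Dinj /eqP; rewrite subr_eq0 => /eqP ->; exact: leS.
have M0 : 0 <= M := le_trans (normr_ge0 _) Lu.
have IB0 : (0 : R) < (#|I| ^ #|B|)%:R by rewrite ltr0n expn_gt0 I0.
have -> : L (\prod_b x (u b)) - \sum_h L (X h) * \prod_b freq R h (u b)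
    = (#|I| ^ #|B|)%:R^-1 * \sum_phi D phi.
  rewrite /D sumrB sumr_const card_ffun mulrBr -[X in _ * X - _]mulr_natl mulrA mulVf ?gt_eqF//.
  rewrite mul1r; congr (_ - _).
  rewrite exchange_big mulr_sumr; apply: eq_bigr => h _.
  by rewrite prod_freq mulrCA -mulr_sumr.
rewrite normrM (@ger0_norm _ _^-1) ?invr_ge0 ?(ltW IB0)// ler_pdivrMl//.
apply: le_trans (ler_norm_sum _ _ _) _.
rewrite (bigID (fun phi : {ffun B -> I} => injectiveb phi)) /= big1 ?add0r; last first.
  by move=> phi /injectiveP /Dinj ->; rewrite normr0.
have DM phi : `|D phi| <= 2 * M.
  by apply: le_trans (ler_normB _ _) _; rewrite mulr_natl mulr2n lerD.
apply: le_trans (ler_sum _ (fun phi _ => DM phi)) _.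
rewrite sumr_const -[leLHS]mulr_natl [leRHS]mulrA ler_wpM2r ?mulr_ge0//.
rewrite mulrA ler_pdivlMr ?ltr0n// -!natrM ler_nat.
have ca : #|fun phi : {ffun B -> I} => injectiveb phi| = (#|I| ^_ #|B|)%N.
  by have := card_inj_ffuns B I; rewrite cardsE.
have cb := cardC (fun phi : {ffun B -> I} => injectiveb phi).
rewrite card_ffun ca in cb.
have := leq_expn_ffact #|I| #|B|; rewrite -cb mulnDl leq_add2l.
by rewrite [X in (_ <= X)%N -> _]mulnC; exact.
Qed.

End Sampling.

(** * Feasible moment vectors of high order are nearly moments of measures *)

(** The constraints of the moment relaxation that involve [z] alone. *)
Definition relaxed (R : realType) (m k : nat) (z : mvec R m (2 * k)) : Prop :=
  psd (@localizing R m k 1 z) /\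
  forall q, q \in constraint_polys R m -> psd (@localizing R m k q z).

(** The pairing with [z], with [R^o] as codomain so that the theory of linear
    forms applies. *)
Definition riesz_functional (R : realType) (m t : nat) (z : mvec R m t)
  (p : mpoly m R) : R^o := pairing p z.

Lemma riesz_functional_linear (R : realType) (m t : nat) (z : mvec R m t) :
  linear_for *%R (riesz_functional R m t z).
Proof.
move=> c p q; rewrite /riesz_functional /pairing mulr_sumr -big_split /=.
by apply: eq_bigr => i _; rewrite mcoeffD mcoeffZ mulrDl mulrA.
Qed.

HB.instance Definition _ (R : realType) (m t : nat) (z : mvec R m t) :=
  GRing.isLinear.Build R (mpoly m R) R^o *%R (riesz_functional R m t z)
    (riesz_functional_linear R m t z).

Lemma localizing_ge0 (R : realType) (m k : nat) (z : mvec R m (2 * k))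
    (q a : mpoly m R) :
  psd (@localizing R m k q z) -> (msize (q * a ^+ 2) <= (2 * k).+1)%N ->
  0 <= pairing (q * a ^+ 2) z.
Proof. by case=> _ q_psd sz; rewrite localizingP. Qed.

(** The square [a ^ 2] makes this predicate stable under multiplication by
    squares, hence a quadratic module; the order beyond which the inequality
    holds may depend on [a], which absorbs all degree bounds. *)
Definition eventually_nonneg (R : realType) (m : nat) (p : mpoly m R) : Prop :=
  forall a : mpoly m R, \forall k \near \oo, forall z : mvec R m (2 * k),
    relaxed R m k z -> 0 <= pairing (a ^+ 2 * p) z.

Lemma near_size (s : nat) : \forall k \near \oo, (s <= (2 * k).+1)%N.
Proof. by apply: filterS (nbhs_infty_ge s) => k /=; lia. Qed.

Lemma eventually_nonneg_gen (R : realType) (m : nat) (q : mpoly m R) :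
  (forall k (z : mvec R m (2 * k)), relaxed R m k z ->
     psd (@localizing R m k q z)) -> eventually_nonneg R m q.
Proof.
move=> q_psd a; near=> k => z rz; rewrite mulrC; apply: localizing_ge0.
  exact: q_psd.
by near: k; apply: near_size.
Unshelve. all: by end_near. Qed.

Lemma eventually_nonneg_qm (R : realType) (m : nat) :
  quadratic_module R (mpoly m R) (eventually_nonneg R m).
Proof.
split.
- by apply: eventually_nonneg_gen => k z [].
- move=> p q Qp Qq a; near=> k => z rz.
  rewrite mulrDr -[pairing _ z]/(riesz_functional R m _ z _) linearD addr_ge0//.
    by move: z rz; near: k; exact: Qp.
  by move: z rz; near: k; exact: Qq.
- move=> a p Qp b; apply: filterS (Qp (b * a)) => k H z rz.
  by rewrite mulrA -exprMn; exact: H.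
Unshelve. all: by end_near. Qed.

(** Barycentric coordinates: the defining linear forms of the simplex. *)
Definition bary (R : realType) (m : nat) (i : 'I_m.+1) : mpoly m R :=
  if unlift ord0 i is Some j then mvar R j else 1 - \sum_(j < m) mvar R j.

Lemma bary_lift (R : realType) (m : nat) (i : 'I_m) :
  bary R m (lift ord0 i) = mvar R i.
Proof. by rewrite /bary liftK. Qed.

Lemma sum_bary (R : realType) (m : nat) : \sum_i bary R m i = 1.
Proof.
have b0 : bary R m ord0 = 1 - \sum_(j < m) mvar R j by rewrite /bary unlift_none.
rewrite big_ord_recl b0 (eq_bigr _ (fun i _ => bary_lift R m i)); exact: subrK.
Qed.

Lemma bary_nonneg (R : realType) (m : nat) (i : 'I_m.+1) :
  eventually_nonneg R m (bary R m i).
Proof.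
apply: eventually_nonneg_gen => k z [_]; apply; rewrite mem_cat /bary.
case: (unlift _ _) => [j|]; last by rewrite inE eqxx orbT.
by rewrite map_f ?mem_enum.
Qed.

(** The other barycentric coordinates add up to [1 - bary i].  These bounds
    make the quadratic module archimedean. *)
Lemma bary_le1 (R : realType) (m : nat) (i : 'I_m.+1) :
  eventually_nonneg R m (1 - bary R m i).
Proof.
rewrite -(sum_bary R m) (bigD1 i) //= addrAC subrr add0r.
apply: (qm_sum _ _ _ (eventually_nonneg_qm R m)) => j _; exact: bary_nonneg.
Qed.

(** Products of barycentric coordinates are not among the constraints of the
    relaxation; [qm_prod] recovers their nonnegativity in the limit. *)
Lemma words_almost_nonneg (R : realType) (m N : nat) (e : R) : 0 < e ->
  \forall k \near \oo, forall z : mvec R m (2 * k), relaxed R m k z ->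
    forall h : {ffun 'I_N -> 'I_m.+1},
      - (e * pairing 1 z) <= pairing (\prod_i bary R m (h i)) z.
Proof.
move=> e0.
have : \forall k \near \oo, forall h : {ffun 'I_N -> 'I_m.+1},
    forall z : mvec R m (2 * k), relaxed R m k z ->
      0 <= pairing (1 ^+ 2 * (\prod_i bary R m (h i) + e%:A)) z.
  apply: filter_forall => h.
  exact: (qm_prod _ _ _ (eventually_nonneg_qm R m) _ _ (fun i => bary R m (h i))
    (fun i => bary_nonneg _ _ _) (fun i => bary_le1 _ _ _) e e0).
apply: filterS => k H z rz h; have := H h z rz.
rewrite expr1n mul1r -![pairing _ z]/(riesz_functional R m _ z _).
by rewrite linearD linearZ /= -lerBlDr sub0r.
Qed.

(** A monomial as the product of the letters of a word, which is the form
    under which [sampling] handles it. *)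
Lemma multinom_word (m : nat) (alpha : multinom m) :
  exists u : 'I_(mdeg alpha) -> 'I_m, forall (A : comNzRingType) (x : 'I_m -> A),
    \prod_i x i ^+ alpha i = \prod_b x (u b).
Proof.
pose s := flatten [seq nseq (alpha i) i | i <- enum 'I_m].
have sE : size s = mdeg alpha.
  rewrite size_flatten /shape -map_comp sumnE big_map mdegE big_enum /=.
  by apply: eq_bigr => i _; rewrite size_nseq.
rewrite -sE; exists (tnth (in_tuple s)) => A x.
transitivity (\prod_(i <- s) x i).
  rewrite big_flatten big_map big_enum /=; apply: eq_bigr => i _.
  by rewrite big_nseq -Monoid.iteropE.
by rewrite (big_tnth _ _ s).
Qed.

Lemma moment_cone_fin (R : realType) (m d : nat) (T : finType) (lambda : T -> R)
    (v : T -> 'I_m -> R) :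
  (forall t, 0 <= lambda t) -> (forall t, simplex (v t)) ->
  moment_cone (\sum_t lambda t *: monomials d (v t)).
Proof.
move=> l0 vs; exists #|T|, (lambda \o enum_val), (v \o enum_val); split=> //=.
by rewrite (reindex (fun i : 'I_#|T| => enum_val i)) //=; exact: (onW_bij _ (enum_val_bij T)).
Qed.

Lemma freq_ge0 (R : realType) (I J : finType) (h : {ffun I -> J}) (a : J) :
  0 <= freq I J R h a.
Proof. by rewrite divr_ge0 ?ler0n ?sumr_ge0. Qed.

Lemma sum_freq (R : realType) (I J : finType) (h : {ffun I -> J}) :
  (0 < #|I|)%N -> \sum_a freq I J R h a = 1.
Proof.
move=> I0; rewrite /freq -mulr_suml exchange_big /=.
under eq_bigr => i _.
  rewrite (bigD1 (h i)) //= eqxx big1 ?addr0; last first.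
    by move=> a /negPf; rewrite eq_sym => ->.
  over.
by rewrite sumr_const mulfV// pnatr_eq0 -lt0n.
Qed.

Lemma freq_simplex (R : realType) (m : nat) (I : finType)
    (h : {ffun I -> 'I_m.+1}) : (0 < #|I|)%N ->
  simplex (fun i => freq I 'I_m.+1 R h (lift ord0 i)).
Proof.
move=> I0; split=> [i|]; first exact: freq_ge0.
by rewrite -(sum_freq R I 'I_m.+1 h I0) big_ord_recl addrK freq_ge0.
Qed.

(** Asymptotic solution of the truncated moment problem: the measure carried by
    the letter frequencies of the words of length [N] has almost the moments [z].
    The error is relative to the mass [pairing 1 z], as no bound on the mass is
    available yet. *)
Lemma near_moment_cone (R : realType) (m d : nat) (e : R) : 0 < e ->
  \forall k \near \oo, forall z : mvec R m (2 * k), relaxed R m k z ->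
    exists y : mvec R m d, moment_cone y /\
      forall beta : bmultinom m d.+1,
        `|pairing (mpolyX R beta) z - y beta| <= e * pairing 1 z.
Proof.
move=> e0.
(* [N >= 4 d^2 (1 + e) / e] makes the collision term of [sampling] at most
   [e / 2] times the mass, and [N >= d] lets the words carry all the monomials. *)
pose N := (d + (Num.truncn (4 * (d ^ 2)%:R * (1 + e) / e)).+1)%N.
have N0 : (0 < N)%N by rewrite /N addnS.
have NR0 : (0 : R) < N%:R by rewrite ltr0n.
have leN : (d ^ 2)%:R / N%:R * (2 * (1 + e)) <= e / 2.
  have : 4 * (d ^ 2)%:R * (1 + e) / e <= N%:R.
    apply: le_trans (ltW (truncnS_gt _)) _; rewrite ler_nat /N; exact: leq_addl.
  rewrite ler_pdivrMr// => H.
  by rewrite mulrAC ler_pdivrMr// ; lra.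
pose W : R := (m.+1 ^ N)%:R.
have W0 : 0 < W by rewrite ltr0n expn_gt0.
pose e' := e / 2 / W.
have e'0 : 0 < e' by rewrite !divr_gt0.
apply: filterS (words_almost_nonneg R m N e' e'0) => k Lh' z rz.
pose L : {scalar mpoly m R} := riesz_functional R m _ z.
pose z0 : R := L 1.
have z00 : 0 <= z0.
  have := localizing_ge0 R m k z 1 1 (proj1 rz).
  by rewrite expr1n mulr1 msize1; apply.
have Lh (h : {ffun 'I_N -> 'I_m.+1}) : - (e' * z0) <= L (\prod_i bary R m (h i)).
  exact: Lh'.
(* The shift by [e' * z0] makes the weights nonnegative. *)
exists (\sum_(h : {ffun 'I_N -> 'I_m.+1})
   (L (\prod_i bary R m (h i)) + e' * z0) *:
      monomials d (fun i => freq 'I_N 'I_m.+1 R h (lift ord0 i))).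
split.
  apply: moment_cone_fin => h; last by apply: freq_simplex; rewrite card_ord.
  by rewrite -lerBlDr sub0r.
move=> beta; rewrite -/z0 -[pairing _ z]/(L _).
have [u uE] := multinom_word m beta.
have bd : (mdeg beta <= d)%N by rewrite -ltnS bmdeg.
pose u' b := lift ord0 (u b).
have -> : mpolyX R beta = \prod_b bary R m (u' b).
  rewrite mpolyXE_id uE; apply: eq_bigr => b _; by rewrite bary_lift.
pose P (h : {ffun 'I_N -> 'I_m.+1}) := \prod_b freq 'I_N 'I_m.+1 R h (u' b).
have P01 h : 0 <= P h <= 1.
  apply/andP; split; first by apply: prodr_ge0 => b _; exact: freq_ge0.
  apply: prodr_ile1 => b _; rewrite freq_ge0 /=.
  rewrite -(sum_freq R 'I_N 'I_m.+1 h) ?card_ord// (bigD1 (u' b)) //= lerDl.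
  by apply: sumr_ge0 => a _; exact: freq_ge0.
have -> : (\sum_(h : {ffun 'I_N -> 'I_m.+1})
   (L (\prod_i bary R m (h i)) + e' * z0) *:
      monomials d (fun i => freq 'I_N 'I_m.+1 R h (lift ord0 i))) beta =
  \sum_(h : {ffun 'I_N -> 'I_m.+1}) L (\prod_i bary R m (h i)) * P h + e' * z0 * \sum_h P h.
  rewrite sum_ffunE mulr_sumr -big_split /=; apply: eq_bigr => h _.
  by rewrite !ffunE uE -mulrDl.
have S := sampling 'I_N 'I_m.+1 'I_(mdeg beta) R _ L (bary R m) u' (e' * z0).
rewrite !card_ord in S.
have {}S := S (leq_trans bd (leq_addr _ _)) N0 (sum_bary R m)
   (mulr_ge0 (ltW e'0) z00) Lh.
rewrite opprD addrA; apply: le_trans (ler_normB _ _) _.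
rewrite [e]splitr mulrDl; apply: lerD.
  apply: le_trans S _; rewrite -/z0.
  have -> : z0 + 2 * (e' * z0) * (m.+1 ^ N)%:R = (1 + e) * z0.
    by rewrite -/W /e'; field; rewrite gt_eqF.
  rewrite (mulrA 2) [leLHS]mulrA ler_wpM2r//; apply: le_trans leN.
  by rewrite ler_wpM2r ?mulr_ge0 ?addr_ge0 ?(ltW e0)// ler_wpM2r ?invr_ge0// ler_nat leq_sqr.
rewrite ger0_norm; last first.
  apply: mulr_ge0; first exact: mulr_ge0 (ltW e'0) z00.
  by apply: sumr_ge0 => h _; case/andP: (P01 h).
have : \sum_h P h <= W.
  rewrite (le_trans (ler_sum _ (fun h _ => proj2 (andP (P01 h)))))//.
  by rewrite sumr_const card_ffun !card_ord.
move=> H; rewrite mulrAC ler_wpM2r//.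
by rewrite -(@ler_pM2l _ e') // in H; apply: le_trans H _; rewrite /e' mulfVK ?gt_eqF.
Qed.

(** * Compactness of the simplex and closedness of the moment cone *)

Lemma continuous_sumR (R : realType) (U : topologicalType) (I : Type) (r : seq I)
    (F : I -> U -> R) :
  (forall i, continuous (F i)) -> continuous (fun x => \sum_(i <- r) F i x).
Proof.
by move=> cF x; apply: cvg_big => [|i _]; [exact: add_continuous | exact: cF].
Qed.

Lemma continuous_prodR (R : realType) (U : topologicalType) (I : Type) (r : seq I)
    (F : I -> U -> R) :
  (forall i, continuous (F i)) -> continuous (fun x => \prod_(i <- r) F i x).
Proof.
by move=> cF x; apply: cvg_big => [|i _]; [exact: mul_continuous | exact: cF].
Qed.

Lemma continuousDR (R : realType) (U : topologicalType) (f g : U -> R) :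
  continuous f -> continuous g -> continuous (fun x => f x + g x).
Proof. by move=> cf cg x; exact: (cvgD (cf x) (cg x)). Qed.

Lemma continuousMR (R : realType) (U : topologicalType) (f g : U -> R) :
  continuous f -> continuous g -> continuous (fun x => f x * g x).
Proof. by move=> cf cg x; exact: (cvgM (cf x) (cg x)). Qed.

Lemma continuousXR (R : realType) (U : topologicalType) (g : U -> R) (n : nat) :
  continuous g -> continuous (fun x => g x ^+ n).
Proof.
by move=> cg x; apply: (@cvg_comp _ _ _ g (fun y => y ^+ n) _ _ _ (cg x));
  exact: exprn_continuous.
Qed.

Lemma closed_ge0 (R : realType) (U : topologicalType) (g : U -> R) :
  continuous g -> closed [set x | 0 <= g x].
Proof. by move=> /continuous_closedP /(_ [set x | 0 <= x]); apply; exact: closed_ge. Qed.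

Lemma closed_forall (U : topologicalType) (I : Type) (P : I -> U -> Prop) :
  (forall i, closed [set x | P i x]) -> closed [set x | forall i, P i x].
Proof.
by move=> Pcl x xcl i; apply: Pcl => A /xcl [y [yP Ay]]; exists y; split.
Qed.

Lemma simplex_le1 (R : realType) (m : nat) (x : 'I_m -> R) i :
  simplex x -> x i <= 1.
Proof.
case=> x0; rewrite subr_ge0; apply: le_trans.
by rewrite (bigD1 i) //= lerDl sumr_ge0.
Qed.

Lemma closed_simplex (R : realType) (U : topologicalType) (m : nat)
    (g : 'I_m -> U -> R) :
  (forall i, continuous (g i)) -> closed [set x | simplex (g ^~ x)].
Proof.
move=> cg; apply: closedI.
  by apply: closed_forall => i; exact: closed_ge0.
apply: closed_ge0 => x; apply: cvgB; first exact: cvg_cst.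
exact: continuous_sumR.
Qed.

Lemma pos_on_simplex (R : realType) (m : nat) (p : mpoly m R) :
  (forall x, simplex x -> 0 < meval x p) ->
  exists2 e : R, 0 < e & forall x, simplex x -> e <= meval x p.
Proof.
move=> p_gt0.
pose S := [set x : 'rV[R]_m | simplex (x ord0)].
have S0 : S !=set0.
  exists 0; split=> [i|]; first by rewrite mxE.
  by rewrite big1 ?subr0// => i _; rewrite mxE.
have Sc : compact S.
  apply: (@subclosed_compact _ _ [set x : 'rV[R]_m | forall i, `[0, 1]%classic (x ord0 i)]).
  - by apply: closed_simplex => i; exact: coord_continuous.
  - by apply: (@rV_compact R _ (fun=> `[0, 1]%classic)) => i; exact: segment_compact.
  - move=> x xS i /=; rewrite in_itv /= (simplex_le1 _ _ _ _ xS) andbT.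
    by case: xS.
have pc : continuous (fun x : 'rV[R]_m => meval (x ord0) p).
  under eq_fun do rewrite mevalE.
  apply: continuous_sumR => a; apply: continuousMR; first exact: cst_continuous.
  by apply: continuous_prodR => i; apply: continuousXR; exact: coord_continuous.
have [x0 x0S x0min] := EVT_min_rV S0 Sc (continuous_subspaceT pc).
rewrite inE in x0S; exists (meval (x0 ord0) p); first exact: p_gt0.
move=> x xS; have := x0min (\row_i x i).
have xE : (\row_i x i) ord0 =1 x by move=> i; rewrite mxE.
rewrite (meval_eq _ xE); apply; rewrite inE; case: xS => x_ge0 x_le1; split=> [i|]; first by rewrite mxE.
by under eq_bigr do rewrite mxE.
Qed.

Lemma linear_dependence (R : fieldType) (T : finType) (r : nat)
    (x : 'I_r -> {ffun T -> R^o}) : (#|T| < r)%N ->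
  exists2 u : 'I_r -> R, exists i, u i != 0 & \sum_i u i *: x i = 0.
Proof.
move=> Tr; pose M := \matrix_(i < r, j < #|T|) (x i (enum_val j) : R).
have : kermx M != 0.
  by rewrite -mxrank_eq0 mxrank_ker subn_eq0 -ltnNge (leq_ltn_trans _ Tr)// rank_leq_col.
case/rowV0Pn => u /sub_kermxP uM u0; exists (u 0).
  by case/rV0Pn: u0 => i ui; exists i.
apply/ffunP => t; rewrite sum_ffunE ffunE.
have E i : (u 0 i *: x i) t = u 0 i * M i (enum_rank t).
  by rewrite ffunE mxE enum_rankK.
rewrite (eq_bigr _ (fun i _ => E i)).
by have /rowP/(_ (enum_rank t)) := uM; rewrite !mxE.
Qed.

(** Conic Caratheodory reduction: subtract the multiple of a linear relation
    that annihilates a first coefficient. *)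
Lemma drop_atom (R : realFieldType) (T : finType) (r : nat)
    (x : 'I_r.+1 -> {ffun T -> R^o}) (lambda : 'I_r.+1 -> R) :
  (#|T| <= r)%N -> (forall i, 0 <= lambda i) ->
  exists (i0 : 'I_r.+1) (mu : 'I_r -> R), (forall j, 0 <= mu j) /\
    \sum_i lambda i *: x i = \sum_j mu j *: x (lift i0 j).
Proof.
move=> Tr l0.
have [u [i1 ui1] ux] : exists2 u : 'I_r.+1 -> R, exists i, 0 < u i &
    \sum_i u i *: x i = 0.
  have [u [i ui] ux] := linear_dependence R T r.+1 x Tr.
  have [ui0|ui0] := ltP 0 (u i); first by exists u => //; exists i.
  exists (fun i => - u i).
    by exists i; rewrite oppr_gt0 lt_neqAle ui.
  by under eq_bigr do rewrite scaleNr; rewrite sumrN ux oppr0.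
case: (@arg_minP _ _ _ i1 (fun i => 0 < u i) (fun i => lambda i / u i) ui1) => i0 ui0 min0.
pose mu i := lambda i - lambda i0 / u i0 * u i.
have mu0 i : 0 <= mu i.
  rewrite subr_ge0; have [ui|ui] := ltP 0 (u i).
    by rewrite -ler_pdivlMr// min0.
  by apply: le_trans (l0 i); rewrite mulr_ge0_le0// divr_ge0// ltW.
exists i0, (mu \o lift i0); split=> [j /=|]; first exact: mu0.
transitivity (\sum_i mu i *: x i).
  under [RHS]eq_bigr do rewrite scalerBl -scalerA.
  by rewrite sumrB -scaler_sumr ux scaler0 subr0.
rewrite (bigD1_ord i0) //= [mu i0]/mu mulfVK ?gt_eqF// subrr scale0r add0r.
by [].
Qed.

(** The moment cone with a prescribed number of atoms, some of which may
    have weight 0. *)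
Definition atomic (R : realType) (m d r : nat) (y : mvec R m d) : Prop :=
  exists (lambda : 'I_r -> R) (v : 'I_r -> 'I_m -> R),
    (forall i, 0 <= lambda i /\ simplex (v i))
    /\ y = \sum_(i < r) lambda i *: monomials d (v i).

Lemma atomic_pad (R : realType) (m d r : nat) (y : mvec R m d) :
  atomic R m d r y -> atomic R m d r.+1 y.
Proof.
move=> [lambda [v [lv ->]]].
exists (fun i => if unlift ord0 i is Some j then lambda j else 0),
  (fun i => if unlift ord0 i is Some j then v j else fun=> 0); split=> [i|].
  case: unliftP => [j _|_]; first exact: lv.
  by split=> //; split=> //; rewrite big1 ?subr0.
rewrite big_ord_recl unlift_none scale0r add0r; apply: eq_bigr => i _.
by rewrite liftK.
Qed.

Lemma moment_cone_atomic (R : realType) (m d : nat) (y : mvec R m d) :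
  moment_cone y -> atomic R m d #|{: bmultinom m d.+1}| y.
Proof.
set D := #|_|; case=> r; rewrite -[exists _, _]/(atomic R m d r y).
elim: r => [|r IH].
  by elim: D => // s IHs /IHs; exact: atomic_pad.
have [rD|Dr] := ltnP r D.
  rewrite -(subnK rD); elim: (D - r.+1)%N => // s IHs /IHs; exact: atomic_pad.
move=> [lambda [v [lv yE]]]; apply: IH.
have [i0 [mu [mu0 E]]] := drop_atom _ _ r (fun i => monomials d (v i)) lambda Dr
  (fun i => proj1 (lv i)).
exists mu, (v \o lift i0); split=> [j|]; last by rewrite yE E.
by split=> //; case: (lv (lift i0 j)).
Qed.

(** With the number of atoms and the total mass bounded, weights and atoms range
    over a compact set, so the distance to [y] is attained. *)
Lemma moment_cone_closed (R : realType) (m d : nat) (y : mvec R m d) :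
  (forall e : R, 0 < e -> exists y' : mvec R m d, moment_cone y' /\
     forall beta : bmultinom m d.+1, `|y' beta - y beta| <= e) ->
  moment_cone y.
Proof.
move=> ycl.
pose D := #|{: bmultinom m d.+1}|.
pose zero : bmultinom m d.+1 := bm0.
pose C : R := `|y zero| + 1.
have C1 : 1 <= C by rewrite lerDr.
(* Coordinates are indexed by pairs (i, o): the weight of atom i for o = None,
   and its j-th coordinate for o = Some j. *)
pose n := #|{: 'I_D * option 'I_m}|.
pose c (i : 'I_D) (o : option 'I_m) (x : 'rV[R]_n) : R :=
   x ord0 (enum_rank (i, o)).
have cc i o : continuous (c i o) by exact: coord_continuous.
pose S : set 'rV[R]_n :=
  [set x | forall i, simplex (fun j => c i (Some j) x)] `&`
  [set x | forall j, `[0, C]%classic (x ord0 j)].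
have Sc : compact S.
  apply: (@subclosed_compact _ _
    [set x : 'rV[R]_n | forall j, `[0, C]%classic (x ord0 j)]).
  - apply: closedI; first by apply: closed_forall => i; exact: closed_simplex.
    apply: closed_forall => j.
    apply: (proj1 (continuous_closedP _) (@coord_continuous _ _ _ ord0 j)).
    exact: itv_closed.
  - by apply: (@rV_compact R _ (fun=> `[0, C]%classic)) => i; exact: segment_compact.
  - by move=> x [].
pose Y (x : 'rV[R]_n) : mvec R m d :=
  \sum_i c i None x *: monomials d (fun j => c i (Some j) x).
pose G x := \sum_beta `|Y x beta - y beta|.
have Gc : continuous G.
  apply: continuous_sumR => beta.
  have Yc : continuous (fun x => Y x beta : R).
    have -> : (fun x => Y x beta) = fun x => \sum_i c i None x *
        \prod_j c i (Some j) x ^+ bmnm beta j.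
      by apply/funext => x; rewrite sum_ffunE; apply: eq_bigr => i _; rewrite !ffunE.
    apply: continuous_sumR => i; apply: continuousMR; first exact: cc.
    by apply: continuous_prodR => j; apply: continuousXR.
  by move=> x; exact: (cvg_norm (cvgB (Yc x) (cvg_cst _))).
have GSc : closed (G @` S).
  apply: compact_closed; first exact: Rhausdorff.
  by apply: continuous_compact => //; exact: continuous_subspaceT.
have mono0 v : monomials d v zero = 1 :> R.
  by rewrite ffunE big1// => i _; rewrite mnm0E expr0.
have [x [xS xI] Gx] : (G @` S) 0.
  apply: GSc => B /nbhs_ballP [e /= e0 eB].
  pose e' := Num.min 1 (e / 2 / D.+1%:R).
  have e'0 : 0 < e' by rewrite lt_min ltr01 !divr_gt0.
  have [y' [/moment_cone_atomic [lambda [v [lv y'E]]] y'y]] := ycl e' e'0.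
  pose x : 'rV[R]_n := \row_t
    (let: (i, o) := enum_val t in if o is Some j then v i j else lambda i).
  have cS i j : c i (Some j) x = v i j by rewrite /c mxE enum_rankK.
  have cN i : c i None x = lambda i by rewrite /c mxE enum_rankK.
  have Yx : Y x = y'.
    rewrite y'E; apply: eq_bigr => i _; rewrite cN; congr (_ *: monomials d _).
    by apply/funext => j; rewrite cS.
  have y'0 : \sum_i lambda i <= C.
    have -> : \sum_i lambda i = y' zero.
      rewrite y'E sum_ffunE; apply: eq_bigr => i _.
      by rewrite ffunE mono0; exact: (esym (mulr1 _)).
    have := y'y zero; rewrite ler_norml => /andP[_]; rewrite lerBlDl => /le_trans; apply.
    by rewrite /C lerD ?ler_norm// ge_min lexx.
  exists (G x); split.
    exists x => //; split=> [i|t] /=.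
      have -> : (fun j => c i (Some j) x) = v i by apply/funext => j; rewrite cS.
      by case: (lv i).
    rewrite in_itv /= mxE; case: (enum_val t) => i [j|]; case: (lv i) => li vi.
      rewrite (le_trans _ C1) ?simplex_le1// andbT; by case: vi.
    rewrite li (le_trans _ y'0)// (bigD1 i) //= lerDl sumr_ge0// => j _.
    by case: (lv j).
  apply: eB; rewrite /ball /= sub0r normrN ger0_norm ?sumr_ge0// /G Yx.
  apply: le_lt_trans (ler_sum _ (fun beta _ => y'y beta)) _.
  rewrite sumr_const -[_ *+ _]mulr_natl -/D.
  apply: (@le_lt_trans _ _ (D.+1%:R * (e / 2 / D.+1%:R))).
    by apply: ler_pM => //; [exact: ltW | rewrite ler_nat | rewrite ge_min lexx orbT].
  by rewrite mulrCA mulfV ?mulr1 ?pnatr_eq0// ltr_pdivrMr// mulr2n; lra.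
have Yy : Y x = y.
  apply/ffunP => beta; apply/eqP; rewrite -subr_eq0 -normr_eq0 -[_ - _]/(Y x beta - y beta : R).
  by have /eqP := Gx; rewrite psumr_eq0// => /allP/(_ beta (mem_index_enum _)).
rewrite -Yy; exists D, (fun i => c i None x), (fun i j => c i (Some j) x).
split=> // i; split; last exact: xS.
have := xI (enum_rank (i, None)).
by rewrite /= in_itv /= => /andP[].
Qed.

(** * The pairing, the relaxations and duality *)

Lemma pairing_expand (R : realType) (m d t : nat) (p : mpoly m R) (z : mvec R m t) :
  (msize p <= d.+1)%N ->
  pairing p z = \sum_(beta : bmultinom m d.+1)
    mcoeff beta p * pairing (mpolyX R beta) z.
Proof.
move=> /mpolywE {1}->; rewrite -[LHS]/(riesz_functional R m t z _) linear_sum.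
by apply: eq_bigr => i _; rewrite linearZ.
Qed.

Lemma mrestrictE (R : realType) (m d t : nat) (z : mvec R m t)
    (beta : bmultinom m d.+1) : (d <= t)%N ->
  Defs.mrestrict d z beta = pairing (mpolyX R beta) z.
Proof.
move=> dt; rewrite ffunE.
have bt : (mdeg beta < t.+1)%N by apply: leq_trans (bmdeg beta) _.
rewrite insubT /= /pairing (bigD1 (BMultinom bt)) //= mcoeffX eqxx mul1r.
rewrite big1 ?addr0// => alpha; rewrite mcoeffX -(inj_eq val_inj) /= eq_sym.
by move=> /negPf ->; rewrite mul0r.
Qed.

Lemma pairing_restrict (R : realType) (m d t : nat) (p : mpoly m R)
    (z : mvec R m t) : (d <= t)%N -> (msize p <= d.+1)%N ->
  pairing p (Defs.mrestrict d z) = pairing p z.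
Proof.
move=> dt sp; rewrite (pairing_expand R m d t p z sp); apply: eq_bigr => beta _.
by rewrite mrestrictE.
Qed.

Lemma pairing_monomials (R : realType) (m t : nat) (p : mpoly m R) (v : 'I_m -> R) :
  (msize p <= t.+1)%N -> pairing p (monomials t v) = meval v p.
Proof.
move=> sp; rewrite {2}(mpolywE sp) linear_sum; apply: eq_bigr => i _.
by rewrite ffunE /= mevalZ mevalX.
Qed.

Lemma pairing_sumr (R : realType) (m t : nat) (p : mpoly m R) (I : Type)
    (r : seq I) (lambda : I -> R) (z : I -> mvec R m t) :
  pairing p (\sum_(i <- r) lambda i *: z i) = \sum_(i <- r) lambda i * pairing p (z i).
Proof.
rewrite /pairing; under eq_bigr do rewrite sum_ffunE mulr_sumr.
rewrite exchange_big; apply: eq_bigr => i _; rewrite mulr_sumr.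
by apply: eq_bigr => beta _; rewrite ffunE mulrCA.
Qed.

Lemma pairing_moment_cone (R : realType) (m d : nat) (p : mpoly m R)
    (y : mvec R m d) (e : R) : (msize p <= d.+1)%N ->
  (forall x, simplex x -> e <= meval x p) -> moment_cone y ->
  e * pairing 1 y <= pairing p y.
Proof.
move=> sp pe [r [lambda [v [lv ->]]]]; rewrite !pairing_sumr mulr_sumr.
apply: ler_sum => i _; have [l0 vi] := lv i.
rewrite !pairing_monomials ?msize1// meval1 mulr1 mulrC.
by rewrite ler_wpM2l// pe.
Qed.

(** Replaces Putinar's Positivstellensatz for a polynomial that is positive on
    the simplex: by [near_moment_cone], [z] is nearly a measure on the simplex, for
    which the inequality holds with [e] instead of [e / 2]. *)
Lemma near_positive (R : realType) (m d : nat) (p : mpoly m R) (e : R) :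
  (msize p <= d.+1)%N -> 0 < e -> (forall x, simplex x -> e <= meval x p) ->
  \forall k \near \oo, forall z : mvec R m (2 * k), relaxed R m k z ->
    e / 2 * pairing 1 z <= pairing p z.
Proof.
move=> sp e0 pe.
pose S := \sum_(beta : bmultinom m d.+1) `|mcoeff beta p|.
have S0 : 0 <= S by apply: sumr_ge0.
have eS : 0 < e + S by lra.
(* Solves [e (1 - e') - S e' = e / 2], the loss being [e e'] on the mass and
   [S e'] on [p]. *)
pose e' := e / 2 / (e + S).
have e'0 : 0 < e' by rewrite !divr_gt0.
apply: filterS (near_moment_cone R m d e' e'0) => k H z /H [y [yc yz]].
have diff (q : mpoly m R) : (msize q <= d.+1)%N ->
    `|pairing q z - pairing q y| <=
    (\sum_(beta : bmultinom m d.+1) `|mcoeff beta q|) * (e' * pairing 1 z).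
  move=> sq; rewrite (pairing_expand R m d _ q z sq) [pairing q y]/pairing -sumrB mulr_suml.
  apply: le_trans (ler_norm_sum _ _ _) _; apply: ler_sum => beta _.
  by rewrite -mulrBr normrM ler_wpM2l.
have d1 := diff 1 _; have dp := diff p sp.
have c1 : \sum_(beta : bmultinom m d.+1) `|mcoeff beta (1 : mpoly m R)| = 1.
  rewrite (bigD1 bm0) //= mcoeff1 eqxx normr1 big1 ?addr0// => beta.
  by rewrite mcoeff1 -(inj_eq val_inj) /= => /negPf ->; rewrite normr0.
have {}d1 : `|pairing 1 z - pairing 1 y| <= e' * pairing 1 z.
  by have := d1; rewrite c1 mul1r; apply; rewrite msize1.
have yp := pairing_moment_cone R m d p y e sp pe yc.
rewrite -/S in dp.
move: d1 dp yp; set z0 := pairing 1 z; set y0 := pairing 1 y.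
set pz := pairing p z; set py := pairing p y.
rewrite !ler_norml => /andP[_ d1] /andP[dp _] yp.
have ed1 : e * (z0 - y0) <= e * (e' * z0) by rewrite ler_wpM2l// ltW.
have : (e + S) * e' * z0 = e / 2 * z0.
  by rewrite /e'; congr (_ * _); field; rewrite gt_eqF.
by lra.
Qed.

Lemma simplex_constraint (R : realType) (m : nat) (q : mpoly m R) (x : 'I_m -> R) :
  q \in constraint_polys R m -> simplex x -> 0 <= meval x q.
Proof.
move=> + xs; have [x0 x1] := xs.
have xE i : meval x (mvar R i) = x i by exact: mevalXU.
rewrite mem_cat !inE => /or3P[/mapP[i _ ->]|/eqP->|/eqP->].
- by rewrite xE.
- rewrite mevalB meval1.
  suff -> : meval x (\sum_i mvar R i) = \sum_i x i by [].
  by rewrite raddf_sum; apply: eq_bigr => i _; exact: xE.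
- rewrite mevalB meval1.
  have -> : meval x (\sum_i mvar R i ^+ 2) = \sum_i x i ^+ 2.
    by rewrite raddf_sum; apply: eq_bigr => i _; rewrite /= rmorphXn /= xE.
  apply: le_trans x1 _; rewrite lerD2l lerN2.
  by apply: ler_sum => i _; rewrite expr2 ler_piMr// simplex_le1.
Qed.

Lemma size_constraint (R : realType) (m : nat) (q : mpoly m R) :
  q \in constraint_polys R m -> (msize q <= 3)%N.
Proof.
have sv i j : (j <= 2)%N -> (msize (mvar R i ^+ j : mpoly m R) <= 3)%N.
  move=> j2; rewrite /mvar mpolyXn msizeX mdegMn mdeg1 mul1n; lia.
have ss j : (j <= 2)%N -> (msize (1 - \sum_(i < m) mvar R i ^+ j) <= 3)%N.
  move=> j2; apply: leq_trans (msizeD_le _ _) _; rewrite msizeN msize1 geq_max /=.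
  by apply: leq_trans (msize_sum _ _ _) _; apply/bigmax_leqP => i _; exact: sv.
rewrite mem_cat !inE => /or3P[/mapP[i _ ->]|/eqP->|/eqP->].
- exact: (sv i 1%N).
- by have := ss 1%N isT; under eq_bigr do rewrite expr1.
- exact: ss.
Qed.

Lemma psd_atomic (R : realType) (m k r : nat) (q : mpoly m R)
    (lambda : 'I_r -> R) (v : 'I_r -> 'I_m -> R) : (0 < k)%N -> (msize q <= 3)%N ->
  (forall i, 0 <= lambda i * meval (v i) q) ->
  psd (@localizing R m k q (\sum_i lambda i *: monomials (2 * k) (v i))).
Proof.
move=> k0 sq lq; split=> [i j|u]; first exact: localizing_sym.
have E (al be : bmultinom m (k - half_deg q).+1) :
    @localizing R m k q (\sum_i lambda i *: monomials (2 * k) (v i)) al be =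
    \sum_i lambda i * meval (v i) q * meval (v i) (mpolyX R al) * meval (v i) (mpolyX R be).
  rewrite /localizing pairing_sumr; apply: eq_bigr => i _.
  have [qE|q0] := eqVneq q 0.
    have qM p : q * p = 0 by rewrite qE mul0r.
    have -> : meval (v i) q = 0 by rewrite qE meval0.
    rewrite qM mul0r mulr0 !mul0r /pairing big1 ?mulr0// => ? _.
    by rewrite mcoeff0 mul0r.
  have X0 (a : multinom m) : mpolyX R a != 0.
    apply/eqP => /(congr1 (mcoeff a)) /eqP.
    by rewrite mcoeffX eqxx mcoeff0 oner_eq0.
  rewrite pairing_monomials ?mevalM ?mulrA// !msizeM ?mulf_neq0// !msizeX.
  have := bmdeg al; have := bmdeg be.
  move: (mdeg (bmnm al)) (mdeg (bmnm be)) => a b; rewrite /half_deg.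
  have : (0 < msize q)%N by rewrite lt0n mmeasure_poly_eq0.
  move: sq; case: (mmeasure _ q) => // -[|[|[|]]] //= _ _; rewrite ?subn0; lia.
under eq_bigr do under eq_bigr do rewrite E mulr_sumr mulr_suml.
under eq_bigr do rewrite exchange_big /=.
rewrite exchange_big /=; apply: sumr_ge0 => i _.
set F := (X in 0 <= X).
have -> : F = lambda i * meval (v i) q *
    (\sum_al u al * meval (v i) (mpolyX R (bmnm al))) ^+ 2.
  rewrite expr2 mulr_suml mulr_sumr; apply: eq_bigr => al _.
  rewrite mulr_sumr mulr_sumr; apply: eq_bigr => be _; ring.
by rewrite mulr_ge0// sqr_ge0.
Qed.

(** The moments up to order [2 k] of the same atomic measure extend [y]; thus
    each [P_k] is a relaxation of the original problem. *)
Lemma moment_cone_relaxed (R : realType) (m d k : nat) (y : mvec R m d) :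
  (0 < k)%N -> (d <= 2 * k)%N -> moment_cone y ->
  exists2 z : mvec R m (2 * k), relaxed R m k z & y = Defs.mrestrict d z.
Proof.
move=> k0 dk [r [lambda [v [lv ->]]]].
exists (\sum_i lambda i *: monomials (2 * k) (v i)).
  split=> [|q qc]; apply: psd_atomic => //.
  - by rewrite msize1.
  - by move=> i; rewrite meval1 mulr1; case: (lv i).
  - exact: size_constraint.
  - by move=> i; case: (lv i) => l0 vs; rewrite mulr_ge0// simplex_constraint.
apply/ffunP => beta; rewrite mrestrictE// pairing_sumr sum_ffunE.
apply: eq_bigr => i _; rewrite pairing_monomials; last first.
  by rewrite msizeX ltnS; apply: leq_trans dk; rewrite -ltnS bmdeg.
by rewrite !ffunE mevalX.
Qed.

(** Linear independence makes [w] a linear function of the pencil, namely the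
    coordinates on the family [ahat]. *)
Lemma pencil_coord (R : realType) (m d l : nat) (ahat : 'I_l.+1 -> mvec R m d) :
  free [tuple ahat i | i < l.+1] ->
  exists2 C : R, 0 <= C & forall (w : 'cV[R]_l) i,
    `|w i 0| <= C * \sum_beta `|mvec_pencil ahat w beta|.
Proof.
set X := [tuple _ | _ < _] => Xfree.
pose delta (beta : bmultinom m d.+1) : mvec R m d :=
  [ffun al => (al == beta)%:R].
have deltaE (y : mvec R m d) : y = \sum_beta y beta *: delta beta.
  apply/ffunP => al; rewrite sum_ffunE (bigD1 al) //= !ffunE eqxx.
  rewrite big1 ?addr0; first exact: (esym (mulr1 _)).
  by move=> be /negPf ab; rewrite !ffunE eq_sym ab; exact: mulr0.
pose C := \sum_(i < l.+1) \sum_beta `|coord X i (delta beta)|.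
exists C; first by apply: sumr_ge0 => i _; apply: sumr_ge0.
move=> w i.
have -> : w i 0 = coord X (lift ord0 i) (mvec_pencil ahat w).
  pose k j := if unlift ord0 j is Some j' then w j' 0 else 1.
  have -> : mvec_pencil ahat w = \sum_(j < l.+1) k j *: X`_j.
    rewrite big_ord_recl /mvec_pencil /k unlift_none scale1r.
    rewrite -[X`_ _]tnth_nth tnth_mktuple; congr (_ + _); apply: eq_bigr => j _.
    by rewrite liftK -[X`_ _]tnth_nth tnth_mktuple.
  by rewrite coord_sum_free// /k liftK.
rewrite {1}(deltaE (mvec_pencil ahat w)) linear_sum mulr_sumr.
apply: le_trans (ler_norm_sum _ _ _) _; apply: ler_sum => beta _.
rewrite linearZ normrM mulrC ler_wpM2r// /C.
rewrite (bigD1 (lift ord0 i)) //= (bigD1 beta) //= -addrA lerDl.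
by apply: addr_ge0; apply: sumr_ge0 => // j _; apply: sumr_ge0.
Qed.

Lemma closed_in_block (R : realType) (U : topologicalType) (b : cone_block)
    (g : U -> 'M[R]_(block_rows b, block_cols b)) :
  (forall r s, continuous (fun x => g x r s)) -> closed [set x | in_block (g x)].
Proof.
case: b g => s g cg /=.
- by apply: closed_forall => i; apply: closed_ge0.
- pose h x := g x 0 ord0 - Num.sqrt (\sum_(i < s) g x 0 (lift ord0 i) ^+ 2).
  have -> : [set x | Num.sqrt (\sum_(i < s) g x 0 (lift ord0 i) ^+ 2) <= g x 0 ord0]
     = [set x | 0 <= h x].
    by apply/seteqP; split=> x /=; rewrite subr_ge0.
  apply: closed_ge0 => x; apply: cvgB; first exact: cg.
  have sc : continuous (fun x => \sum_(i < s) g x 0 (lift ord0 i) ^+ 2).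
    by apply: continuous_sumR => i; apply: continuousXR.
  apply: (@cvg_comp _ _ _ _ (@Num.sqrt R) _ _ _ (sc x)).
  exact: sqrt_continuous.
- apply: closedI.
    apply: closed_forall => i; apply: closed_forall => j.
    have -> : [set x | g x i j = g x j i] =
        [set x | 0 <= g x i j - g x j i] `&` [set x | 0 <= g x j i - g x i j].
      apply/seteqP; split=> x /=; first by move=> ->; rewrite subrr.
      by rewrite !subr_ge0 => -[h1 h2]; apply: le_anti; rewrite h1 h2.
    by apply: closedI; apply: closed_ge0 => x; apply: cvgB; exact: cg.
  apply: closed_forall => v; apply: closed_ge0.
  apply: continuous_sumR => i; apply: continuous_sumR => j.
  apply: continuousMR; last exact: cst_continuous.
  by apply: continuousMR; first exact: cst_continuous.
Qed.

Lemma closed_cone_pencil (R : realType) (l N : nat) (K : 'I_N -> cone_block)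
    (f : 'I_l.+1 -> cone_vec R K) :
  closed [set w : 'cV[R]_l | in_cone (cone_pencil f w)].
Proof.
apply: closed_forall => j; apply: closed_in_block => r s.
have -> : (fun w : 'cV[R]_l => cone_pencil f w j r s) =
    fun w => f ord0 j r s + \sum_(i < l) w i 0 * f (lift ord0 i) j r s.
  apply/funext => w; rewrite mxE summxE; congr (_ + _).
  by apply: eq_bigr => i _; rewrite mxE.
apply: continuousDR; first exact: cst_continuous.
apply: continuous_sumR => i; apply: continuousMR; last exact: cst_continuous.
exact: coord_continuous.
Qed.

Lemma continuous_pencil (R : realType) (m d l : nat)
    (ahat : 'I_l.+1 -> mvec R m d) (beta : bmultinom m d.+1) :
  continuous (fun w : 'cV[R]_l => mvec_pencil ahat w beta : R).
Proof.
have -> : (fun w : 'cV[R]_l => mvec_pencil ahat w beta) =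
    fun w => ahat ord0 beta + \sum_(i < l) w i 0 * ahat (lift ord0 i) beta.
  apply/funext => w; rewrite ffunE sum_ffunE; congr (_ + _).
  by apply: eq_bigr => i _; rewrite ffunE.
apply: continuousDR; first exact: cst_continuous.
apply: continuous_sumR => i; apply: continuousMR; last exact: cst_continuous.
exact: coord_continuous.
Qed.

Lemma objectiveE (R : realType) (l : nat) (c w : 'cV[R]_l) :
  objective c w = \sum_i w i 0 * c i 0.
Proof. by rewrite /objective mxE; apply: eq_bigr => i _; rewrite mxE mulrC. Qed.

(** The difference of the two sides is the pairing of [eta] with an element of
    the cone. *)
Lemma weak_duality (R : realType) (m d l N : nat) (K : 'I_N -> cone_block)
    (c : 'cV[R]_l) (ahat : 'I_l.+1 -> mvec R m d) (f : 'I_l.+1 -> cone_vec R K)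
    (p : mpoly m R) (eta : cone_vec R K) (w : 'cV[R]_l) :
  feasible_D c ahat f p eta -> in_cone (cone_pencil f w) ->
  pairing p (mvec_pencil ahat w) <=
    objective c w + (pairing p (ahat ord0) + cone_dot (f ord0) eta).
Proof.
move=> [cE _ [_ eta_dual]] /eta_dual.
have -> : cone_dot (cone_pencil f w) eta =
    cone_dot (f ord0) eta + \sum_i w i 0 * cone_dot (f (lift ord0 i)) eta.
  rewrite /cone_dot; under [X in _ + X]eq_bigr do rewrite mulr_sumr.
  rewrite [X in _ + X]exchange_big -big_split /=; apply: eq_bigr => j _.
  under [X in _ + X]eq_bigr do rewrite mulr_sumr.
  rewrite [X in _ + X]exchange_big -big_split /=; apply: eq_bigr => r _.
  under [X in _ + X]eq_bigr do rewrite mulr_sumr.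
  rewrite [X in _ + X]exchange_big -big_split /=; apply: eq_bigr => s _.
  rewrite mxE summxE mulrDl mulr_suml; congr (_ + _).
  by apply: eq_bigr => i _; rewrite mxE mulrA.
have -> : pairing p (mvec_pencil ahat w) =
    pairing p (ahat ord0) + \sum_i w i 0 * pairing p (ahat (lift ord0 i)).
  rewrite -pairing_sumr /pairing -big_split /=; apply: eq_bigr => beta _.
  by rewrite ffunE mulrDr.
rewrite objectiveE; under [X in _ -> _ <= X + _]eq_bigr do rewrite -cE mulrDr.
rewrite big_split /=; lra.
Qed.

Lemma mx_norm_le_sum (R : realType) (l : nat) (w : 'cV[R]_l) :
  `|w| <= \sum_i `|w i 0|.
Proof.
rewrite -[leLHS]/(mx_norm w).
have [w0|/mx_norm_neq0 [[i j] /= E]] := eqVneq (mx_norm w) 0.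
  by rewrite w0; exact: sumr_ge0.
rewrite E (ord1 j) (bigD1 i) //= lerDl; exact: sumr_ge0.
Qed.

Lemma cluster_closed (U : topologicalType) (u : nat -> U) (E : set U) (x : U) :
  closed E -> (\forall k \near \oo, E (u k)) -> cluster (u @ \oo) x -> E x.
Proof. by move=> Ecl Eu xcl; apply: Ecl => B; exact: xcl. Qed.

(** * Convergence of the relaxations *)

Lemma moment_cone_le (R : realType) (m d : nat) (y : mvec R m d)
    (beta : bmultinom m d.+1) : moment_cone y -> `|y beta| <= y bm0.
Proof.
move=> [r [lambda [v [lv ->]]]]; rewrite !sum_ffunE.
apply: le_trans (ler_norm_sum _ _ _) _; apply: ler_sum => i _.
have [l0 vs] := lv i; rewrite !ffunE normrM (ger0_norm l0) ler_wpM2l//.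
rewrite [leRHS]big1; last by move=> j _; rewrite mnm0E expr0.
rewrite ger0_norm; last by apply: prodr_ge0 => j _; rewrite exprn_ge0; case: vs.
apply: prodr_ile1 => j _; have v0 : 0 <= v i j by case: vs.
by rewrite exprn_ge0//= exprn_ile1// simplex_le1.
Qed.

(** Weak duality with [p] positive bounds the mass of [z k]; then all
    moments of degree at most [d] are bounded, hence so is [w k], and the error in
    [near_moment_cone] becomes absolute, which puts the limits in the closed
    moment cone. *)
Lemma bounded_values_limits_feasible (R : realType) (m d l N : nat)
    (K : 'I_N -> cone_block) (c : 'cV[R]_l)
    (ahat : 'I_l.+1 -> mvec R m d) (f : 'I_l.+1 -> cone_vec R K)
    (p : mpoly m R) (eta : cone_vec R K)
    (w : nat -> 'cV[R]_l) (z : forall k : nat, mvec R m (2 * k)) (v : R) :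
  free [tuple ahat i | i < l.+1] ->
  feasible_D c ahat f p eta -> (forall x, simplex x -> 0 < meval x p) ->
  (forall k, (uphalf d <= k)%N ->
     feasible_Pk ahat f (w k) (z k) /\ objective c (w k) <= v) ->
  bounded_set [set w k | k in [set k : nat | (uphalf d <= k)%N]] /\
  forall wstar : 'cV[R]_l, cluster (w @ \oo) wstar -> feasible_P ahat f wstar.
Proof.
move=> ahat_free pD /pos_on_simplex [e e0 pe] wz.
have [_ [sp _] _] := pD.
have d2 k : (uphalf d <= k)%N -> (d <= 2 * k)%N by rewrite uphalfE; lia.
have near_d : \forall k \near \oo, (uphalf d <= k)%N by exact: nbhs_infty_ge.
have wzr k : (uphalf d <= k)%N -> relaxed R m k (z k).
  by move=> /wz [[]].
have pencilE k (beta : bmultinom m d.+1) : (uphalf d <= k)%N ->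
    mvec_pencil ahat (w k) beta = pairing (mpolyX R beta) (z k).
  by move=> dk; have [[-> _ _ _] _] := wz k dk; rewrite mrestrictE// d2.
have [M M0 zM] : exists2 M : R, 0 < M &
    \forall k \near \oo, pairing 1 (z k) <= M.
  pose B := v + (pairing p (ahat ord0) + cone_dot (f ord0) eta).
  exists (`|B| * (e / 2)^-1 + 1); first by rewrite ltr_wpDl// mulr_ge0 ?invr_ge0 ?divr_ge0 ?(ltW e0).
  apply: filterS2 near_d (near_positive R m d p e sp e0 pe) => k dk /(_ (z k) (wzr k dk)).
  have [[yz wK _ _] wv] := wz k dk.
  rewrite -(pairing_restrict R m d _ p (z k) (d2 k dk) sp) -yz => /le_trans H.
  have {}H : e / 2 * pairing 1 (z k) <= `|B|.
    apply: le_trans (ler_norm B); apply/H/(le_trans (weak_duality _ _ _ _ _ _ _ _ _ _ _ _ pD wK)).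
    by rewrite lerD2r.
  by rewrite -ler_pdivlMl ?divr_gt0// in H; rewrite (le_trans H)// mulrC lerDl.
have close (e' : R) : 0 < e' -> \forall k \near \oo, exists y' : mvec R m d,
    moment_cone y' /\ forall beta : bmultinom m d.+1,
      `|mvec_pencil ahat (w k) beta - y' beta| <= e'.
  move=> e'0; have e'M0 : 0 < e' / M by rewrite divr_gt0.
  have H := near_moment_cone R m d (e' / M) e'M0.
  apply: filterS3 near_d zM H => k dk zkM /(_ (z k) (wzr k dk)) [y [yc yz]].
  exists y; split=> // beta; rewrite pencilE//; apply: le_trans (yz beta) _.
  by rewrite -[leRHS](divfK (lt0r_neq0 M0)) ler_wpM2l// ltW.
split.
  have [C C0 wC] := pencil_coord R m d l ahat ahat_free.
  pose W := C * (3 * M *+ #|{: bmultinom m d.+1}|) *+ l.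
  have [k0 _ wk0] : \forall k \near \oo, `|w k| <= W.
    apply: filterS3 near_d zM (near_moment_cone R m d 1 ltr01) =>
      k dk zkM /(_ (z k) (wzr k dk)) [y [yc yz]].
    have y0 : y bm0 <= 2 * M.
      have := yz bm0; rewrite mul1r mpolyX0 ler_norml => /andP[y0 _].
      by move: y0 zkM; move: (pairing 1 (z k)) (y bm0) => a b; lra.
    apply: le_trans (mx_norm_le_sum R l (w k)) _.
    apply: le_trans (ler_sum _ (fun i _ => wC (w k) i)) _.
    rewrite sumr_const card_ord lerMn2r; apply/orP; right.
    rewrite ler_wpM2l// -sumr_const; apply: ler_sum => beta _; rewrite pencilE//.
    have yb := le_trans (moment_cone_le R m d y beta yc) y0.
    have := yz beta; rewrite mul1r => /le_trans /(_ zkM) zb.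
    have -> : 3 * M = M + 2 * M by ring.
    by rewrite -[X in `|X|](subrK (y beta)) (le_trans (ler_normD _ _))// lerD.
  pose W' := \sum_(k < k0) `|w k| + `|W|.
  exists W'; split; first exact: num_real.
  move=> x /ltW Wx _ [k _ <-]; apply: le_trans Wx; rewrite /W'.
  have [kk0|k0k] := ltnP k k0.
    rewrite (bigD1 (Ordinal kk0)) //= -addrA lerDl addr_ge0// sumr_ge0//.
  by apply: le_trans (wk0 k k0k) _; rewrite (le_trans (ler_norm _))// lerDr sumr_ge0.
move=> wstar wcl; split; last first.
  apply: (cluster_closed _ w _ _ (closed_cone_pencil R l N K f) _ wcl).
  by apply: filterS near_d => k /wz [[]].
apply: moment_cone_closed => e' e'0.
have e'2 : 0 < e' / 2 by rewrite divr_gt0.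
have near_coord (beta : bmultinom m d.+1) : \forall u \near wstar,
    `|mvec_pencil ahat wstar beta - mvec_pencil ahat u beta : R| < e' / 2.
  by have /cvgrPdist_lt /(_ _ e'2) := continuous_pencil R m d l ahat beta wstar.
have B : \forall u \near wstar, forall beta : bmultinom m d.+1,
    `|mvec_pencil ahat wstar beta - mvec_pencil ahat u beta : R| < e' / 2.
  exact: filter_forall near_coord.
have [u [[y' [yc yw]] uB]] := wcl [set u | exists y' : mvec R m d,
    moment_cone y' /\ forall beta : bmultinom m d.+1,
      `|mvec_pencil ahat u beta - y' beta| <= e' / 2] _ (close _ e'2) B.
exists y'; split=> // beta; rewrite distrC [e']splitr.
by apply: le_trans (ler_distD (mvec_pencil ahat u beta) _ _) _; rewrite lerD// ltW.
Qed.
Theorem theorem4p2 (R : realType) (n d l : nat)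
    (n_ge2 : (2 <= n)%N) (d_ge1 : (1 <= d)%N) (l_ge1 : (1 <= l)%N)
    (c : 'cV[R]_l)
    (A : 'I_l.+1 -> tensor R n d) (A_sym : forall i, sym_tensor (A i))
    (a : 'I_l.+1 -> hvec R n d) (a_def : forall i, tensor_vec (A i) (a i))
    (ahat : 'I_l.+1 -> mvec R n.-1 d) (ahat_def : forall i, ahat i = hat (a i))
    (N : nat) (K : 'I_N -> cone_block)
    (f : 'I_l.+1 -> cone_vec R K) (f_space : forall i, in_space (f i))
    (ahat_free : free [tuple ahat i | i < l.+1])
    (P_feasible : exists w : 'cV[R]_l, feasible_P ahat f w)
    (D_feasible : exists (p : mpoly n.-1 R) (eta : cone_vec R K),
       feasible_D c ahat f p eta /\ forall x, simplex x -> 0 < meval x p)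
    (w : nat -> 'cV[R]_l) (z : forall k : nat, mvec R n.-1 (2 * k))
    (wz_min : forall k : nat, (uphalf d <= k)%N ->
       minimizer_Pk c ahat f (w k) (z k)) :
  bounded_set [set w k | k in [set k : nat | (uphalf d <= k)%N]] /\
  forall wstar : 'cV[R]_l, cluster (w @ \oo) wstar -> minimizer_P c ahat f wstar.
Proof.
have [w0 [w0c w0K]] := P_feasible.
have d2 k : (uphalf d <= k)%N -> (d <= 2 * k)%N by rewrite uphalfE; lia.
have optimal w' : feasible_P ahat f w' -> forall k, (uphalf d <= k)%N ->
    objective c (w k) <= objective c w'.
  move=> [w'c w'K] k dk; have [_ wmin] := wz_min k dk.
  have k0 : (0 < k)%N by apply: leq_trans dk; rewrite uphalfE half_gt0 ltnS.
  have [z' [z1 zq] z'E] := moment_cone_relaxed R n.-1 d k _ k0 (d2 k dk) w'c.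
  by apply: (wmin w' z').
have [p [eta [pD p_gt0]]] := D_feasible.
have [wb wf] := bounded_values_limits_feasible R n.-1 d l N K c ahat f p eta w z
  (objective c w0) ahat_free pD p_gt0
  (fun k dk => conj (proj1 (wz_min k dk)) (optimal w0 (conj w0c w0K) k dk)).
split=> // wstar wcl; split; first exact: wf.
move=> w' w'P.
apply: (cluster_closed _ w [set u | objective c u <= objective c w'] wstar _ _ wcl).
  have oc : continuous (fun u : 'cV[R]_l => \sum_i u i 0 * c i 0).
    apply: continuous_sumR => i; apply: continuousMR; last exact: cst_continuous.
    exact: coord_continuous.
  have -> : [set u | objective c u <= objective c w'] =
     (fun u : 'cV[R]_l => \sum_i u i 0 * c i 0) @^-1` [set x | x <= objective c w'].
    by apply/seteqP; split=> u /=; rewrite (objectiveE R l c u).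
  by apply: (proj1 (continuous_closedP _) oc); exact: closed_le.
apply: filterS (nbhs_infty_ge (uphalf d)) => k; exact: optimal.
Qed.
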